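(* Let $\Bbbk$ be an algebraically closed field of characteristic $p>0$, and let $H=\Bbbk[G]$ for some elementary abelian $p$-group $G$. Then any $H$-cleft extension of the semisimple algebra $A=\Bbbk[x]/(x^p-x)$ is twist equivalent to either $A\otimes H$ or $\mathcal H(\Bbbk[C]^* )\otimes\Bbbk[G']$ for some subgroups $C,G'$ of $G$ such that $C\cong C_p$ and $C\oplus G'=G$, where $\Bbbk[G]$ is naturally identified with $\Bbbk[C]\otimes\Bbbk[G']$ and $A$ is identified with $\Bbbk[C]^*$. In particular, if $G=C_p$, then any $H$-cleft extension of $A=H^*$ is twist equivalent to one of the following smash products: (1) the tensor product algebra $\Bbbk[C_p]^*\otimes\Bbbk[C_p]$; (2) the Heisenberg double $\mathcal H(\Bbbk[C_p]^* )$.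
   Context: $C_p$ is the cyclic group of order $p$; $\Bbbk[C_p]^*\cong\Bbbk[x]/(x^p-x)$ as algebras. Elementary abelian $p$-groups are finite here. Heisenberg double: for a finite-dimensional Hopf algebra $L$, $L^*$ is a left $L$-module algebra via $h\rightharpoonup f=\sum f_2(h)f_1$, and $\mathcal H(L^* )=L^*\#L$ is the corresponding smash product, with multiplication $(a\#h)(b\#k)=\sum a(h_1\rightharpoonup b)\#h_2k$; it is an $L$-cleft extension of $L^*=L^*\#1$ with right $L$-coaction $\mathrm{id}\otimes\Delta$. Then $\mathcal H(\Bbbk[C]^* )\otimes\Bbbk[G']$ is a $\Bbbk[C]\otimes\Bbbk[G']$-cleft extension of $\Bbbk[C]^*$, and $A\otimes H$ is an $H$-cleft extension of $A$, in the evident way. Let $B$ be a right $H$-comodule algebra with coaction $\rho_B$ and let $A\subseteq B$ be a subalgebra. $A\subseteq B$ is an $H$-cleft extension if $B^{co H}=A$ and there is a convolution-invertible right $H$-comodule map $H\to B$. Two $H$-cleft extensions $B,B'$ of $A$ are twist equivalent if there exist an algebra automorphism $\varphi$ of $A$, a Hopf algebra automorphism $\phi$ of $H$ and an algebra isomorphism $f:B\to B'$ such that $f(ab)=\varphi(a)f(b)$ for $a\in A$, $b\in B$, and $(f\otimes\mathrm{id})\circ\rho_B=(\mathrm{id}\otimes\phi)\circ\rho_{B'}\circ f$. *)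

(* Defs.v *)
From HB Require Import structures.
From mathcomp Require Import all_boot all_order all_algebra all_fingroup.
From mathcomp Require Import all_solvable.
From mathcomp Require Import generic_quotient qpoly.
From mathcomp Require Import boolp.
From mathcomp Require classical_sets.

Set Implicit Arguments.
Unset Strict Implicit.
Unset Printing Implicit Defensive.

Import GRing.Theory.
Local Open Scope ring_scope.
Local Open Scope quotient_scope.

Reserved Notation "v ⊗ w" (at level 39, left associativity).

Section Tensor.
Variables (k : fieldType) (V W : lmodType k).

(* A formal sum of pure tensors is a sequence of pairs; [teq] is the congruence
   generated by the bilinearity relations. *)
Inductive teq : seq (V * W) -> seq (V * W) -> Prop :=
| teq_refl s : teq s s
| teq_sym s t : teq s t -> teq t s
| teq_trans s t u : teq s t -> teq t u -> teq s u
| teq_cat s s' t t' : teq s s' -> teq t t' -> teq (s ++ t) (s' ++ t')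
| teq_comm s t : teq (s ++ t) (t ++ s)
| teq_addl v v' w : teq [:: (v + v', w)] [:: (v, w); (v', w)]
| teq_addr v w w' : teq [:: (v, w + w')] [:: (v, w); (v, w')]
| teq_scale (a : k) v w : teq [:: (a *: v, w)] [:: (v, a *: w)]
| teq_zero w : teq [:: (0, w)] [::].

Definition teqb : rel (seq (V * W)) := fun s t => `[< teq s t >].

Lemma teqb_refl : reflexive teqb.
Proof. by move=> s; apply/asboolP; apply: teq_refl. Qed.
Lemma teqb_sym : symmetric teqb.
Proof. by move=> s t; apply/asboolP/asboolP; apply: teq_sym. Qed.
Lemma teqb_trans : transitive teqb.
Proof. by move=> s t u /asboolP ? /asboolP ?; apply/asboolP; apply: teq_trans; eauto. Qed.

Canonical teqb_equiv := EquivRel teqb teqb_refl teqb_sym teqb_trans.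

Definition tensor := {eq_quot teqb}.
HB.instance Definition _ : EqQuotient _ teqb tensor := EqQuotient.on tensor.
HB.instance Definition _ := Choice.on tensor.

Implicit Types (s t : seq (V * W)) (x y z : tensor).

Definition tens (v : V) (w : W) : tensor := \pi_tensor [:: (v, w)].

Lemma pi_teq s t : teq s t <-> \pi_tensor s = \pi_tensor t.
Proof. by split=> [st|/eqmodP/asboolP //]; apply/eqmodP/asboolP. Qed.

Lemma teq_repr s : teq (repr (\pi_tensor s)) s.
Proof. by apply/pi_teq; rewrite reprK. Qed.

Definition tensor_add x y : tensor := \pi_tensor (repr x ++ repr y).
Definition tensor_opp x : tensor := \pi_tensor [seq (- i.1, i.2) | i <- repr x].
Definition tensor_scale (a : k) x : tensor :=
  \pi_tensor [seq (a *: i.1, i.2) | i <- repr x].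

Lemma tensor_addE s t : tensor_add (\pi_tensor s) (\pi_tensor t) = \pi_tensor (s ++ t).
Proof. by rewrite /tensor_add; apply/pi_teq; apply: teq_cat; apply: teq_repr. Qed.

Lemma teq_map (f : V -> V) :
  f 0 = 0 -> {morph f : u v / u + v} -> scalable f -> forall s t,
  teq s t -> teq [seq (f i.1, i.2) | i <- s] [seq (f i.1, i.2) | i <- t].
Proof.
move=> f0 fD fZ s t.
elim=> {s t} /=.
- by move=> s; apply: teq_refl.
- by move=> s t _; apply: teq_sym.
- by move=> s t u _ ? _ ?; apply: teq_trans; eauto.
- by move=> *; rewrite !map_cat; apply: teq_cat.
- by move=> *; rewrite !map_cat; apply: teq_comm.
- by move=> *; rewrite fD; apply: teq_addl.
- by move=> *; apply: teq_addr.
- by move=> *; rewrite fZ; apply: teq_scale.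
- by move=> *; rewrite f0; apply: teq_zero.
Qed.

Lemma tensor_scaleE a s :
  tensor_scale a (\pi_tensor s) = \pi_tensor [seq (a *: i.1, i.2) | i <- s].
Proof.
rewrite /tensor_scale /tensor_opp; apply/pi_teq/(@teq_map ( *:%R a)); last exact: teq_repr.
- by rewrite scaler0.
- by move=> u v; rewrite scalerDr.
by move=> b u /=; rewrite !scalerA mulrC.
Qed.

Lemma tensor_oppE s : tensor_opp (\pi_tensor s) = \pi_tensor [seq (- i.1, i.2) | i <- s].
Proof.
rewrite /tensor_scale /tensor_opp; apply/pi_teq/(@teq_map (@GRing.opp V)); last exact: teq_repr.
- by rewrite oppr0.
- by move=> u v; rewrite opprD.
by move=> b u /=; rewrite scalerN.
Qed.

Lemma tensorP (P : tensor -> Prop) : (forall s, P (\pi_tensor s)) -> forall x, P x.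
Proof. by move=> H x; rewrite -[x]reprK. Qed.

Fact tensor_addA : associative tensor_add.
Proof.
elim/tensorP=> s; elim/tensorP=> t; elim/tensorP=> u.
by rewrite !tensor_addE catA.
Qed.
Fact tensor_addC : commutative tensor_add.
Proof.
elim/tensorP=> s; elim/tensorP=> t.
by rewrite !tensor_addE; apply/pi_teq/teq_comm.
Qed.
Fact tensor_add0 : left_id (\pi_tensor [::]) tensor_add.
Proof. by elim/tensorP=> s; rewrite tensor_addE. Qed.
Fact tensor_addN : left_inverse (\pi_tensor [::]) tensor_opp tensor_add.
Proof.
elim/tensorP=> s; rewrite tensor_oppE tensor_addE; apply/pi_teq.
elim: s => [|[v w] s IHs] /=; first exact: teq_refl.
set s' := map _ s in IHs *.
apply: (@teq_trans _ (([:: (- v, w)] ++ [:: (v, w)]) ++ (s' ++ s))).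
  rewrite -[_ :: _]/([:: (- v, w)] ++ (s' ++ ([:: (v, w)] ++ s))) -catA.
  apply: teq_cat; first exact: teq_refl.
  rewrite catA [X in teq _ X]catA.
  by apply: teq_cat; [apply: teq_comm|apply: teq_refl].
rewrite -[[::]]cats0; apply: teq_cat => //.
apply: (@teq_trans _ [:: (- v + v, w)]); first exact/teq_sym/teq_addl.
by rewrite addNr; apply: teq_zero.
Qed.

HB.instance Definition _ :=
  GRing.isZmodule.Build tensor tensor_addA tensor_addC tensor_add0 tensor_addN.

Lemma piD s t : \pi_tensor (s ++ t) = \pi_tensor s + \pi_tensor t.
Proof. exact/esym/tensor_addE. Qed.

Lemma piE s : \pi_tensor s = \sum_(i <- s) tens i.1 i.2.
Proof.
elim: s => [|[v w] s IHs]; first by rewrite big_nil.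
by rewrite big_cons -cat1s piD IHs.
Qed.

Lemma tensE x : x = \sum_(i <- repr x) tens i.1 i.2.
Proof. by rewrite -piE reprK. Qed.

Fact tensor_scaleA a b x :
  tensor_scale a (tensor_scale b x) = tensor_scale (a * b) x.
Proof.
elim/tensorP: x => s; rewrite !tensor_scaleE -map_comp; congr (\pi_tensor _).
by apply: eq_map => i /=; rewrite scalerA.
Qed.
Fact tensor_scale1 : left_id 1 tensor_scale.
Proof.
elim/tensorP=> s; rewrite tensor_scaleE; congr (\pi_tensor _).
by rewrite -[RHS]map_id; apply: eq_map => -[v w] /=; rewrite scale1r.
Qed.
Fact tensor_scaleDr : right_distributive tensor_scale +%R.
Proof.
move=> a; elim/tensorP=> s; elim/tensorP=> t.
by rewrite -piD !tensor_scaleE map_cat piD.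
Qed.
Fact tensor_scaleDl x : {morph tensor_scale^~ x : a b / a + b}.
Proof.
move=> a b; elim/tensorP: x => s; rewrite !tensor_scaleE !piE !big_map -big_split /=.
apply: eq_bigr => -[v w] _ /=; rewrite /tens -piD scalerDl.
exact/pi_teq/teq_addl.
Qed.

HB.instance Definition _ := GRing.Zmodule_isLmodule.Build k tensor
  tensor_scaleA tensor_scale1 tensor_scaleDr tensor_scaleDl.

Lemma tensDl w : {morph tens^~ w : v v' / v + v'}.
Proof. by move=> v v'; rewrite /tens -piD; apply/pi_teq/teq_addl. Qed.
Lemma tensDr v : {morph tens v : w w' / w + w'}.
Proof. by move=> w w'; rewrite /tens -piD; apply/pi_teq/teq_addr. Qed.
Lemma tensZl a v w : tens (a *: v) w = a *: tens v w.
Proof. exact/esym/tensor_scaleE. Qed.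
Lemma tensZr a v w : tens v (a *: w) = a *: tens v w.
Proof. by rewrite -tensZl; apply/esym/pi_teq/teq_scale. Qed.

Lemma tens_ind (P : tensor -> Prop) : P 0 ->
  (forall v w, P (tens v w)) -> (forall x y, P x -> P y -> P (x + y)) ->
  forall x, P x.
Proof. by move=> P0 Pt PD x; rewrite (tensE x); elim/big_ind: _. Qed.

Definition bilin (U : lmodType k) (f : V -> W -> U) :=
  (forall w, linear (f^~ w)) /\ (forall v, linear (f v)).

(* The map V ⊗ W -> U induced by a bilinear map f (see [tlift_tens]); its value
   is irrelevant when f is not bilinear. *)
Definition tlift (U : lmodType k) (f : V -> W -> U) (x : tensor) : U :=
  \sum_(i <- repr x) f i.1 i.2.

Section Lift.
Variables (U : lmodType k) (f : V -> W -> U).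
Hypothesis f_bilin : bilin f.

Lemma bilin0l w : f 0 w = 0.
Proof. by have := f_bilin.1 w (-1) 0 0; rewrite scaler0 addr0 scaleN1r addNr. Qed.
Lemma bilin0r v : f v 0 = 0.
Proof. by have := f_bilin.2 v (-1) 0 0; rewrite scaler0 addr0 scaleN1r addNr. Qed.
Lemma bilinDl w : {morph f^~ w : v v' / v + v'}.
Proof. by move=> v v'; have := f_bilin.1 w 1 v v'; rewrite !scale1r. Qed.
Lemma bilinDr v : {morph f v : w w' / w + w'}.
Proof. by move=> w w'; have := f_bilin.2 v 1 w w'; rewrite !scale1r. Qed.
Lemma bilinZl a v w : f (a *: v) w = a *: f v w.
Proof. by have := f_bilin.1 w a v 0; rewrite !addr0 bilin0l addr0. Qed.
Lemma bilinZr a v w : f v (a *: w) = a *: f v w.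
Proof. by have := f_bilin.2 v a w 0; rewrite !addr0 bilin0r addr0. Qed.

Lemma tlift_teq s t : teq s t ->
  \sum_(i <- s) f i.1 i.2 = \sum_(i <- t) f i.1 i.2.
Proof.
elim=> {s t} //.
- by move=> s t u _ -> _ ->.
- by move=> s s' t t' _ IHs _ IHt; rewrite !big_cat /= IHs IHt.
- by move=> s t; rewrite !big_cat /= addrC.
- by move=> v v' w; rewrite !big_cons !big_nil !addr0 bilinDl.
- by move=> v w w'; rewrite !big_cons !big_nil !addr0 bilinDr.
- by move=> a v w; rewrite !big_seq1 /= bilinZl bilinZr.
- by move=> w; rewrite big_seq1 big_nil bilin0l.
Qed.

Lemma tlift_pi s : tlift f (\pi_tensor s) = \sum_(i <- s) f i.1 i.2.
Proof. exact/tlift_teq/teq_repr. Qed.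

Lemma tlift_tens v w : tlift f (tens v w) = f v w.
Proof. by rewrite tlift_pi big_seq1. Qed.

Lemma tliftD : {morph tlift f : x y / x + y}.
Proof.
elim/tensorP=> s; elim/tensorP=> t.
by rewrite -piD !tlift_pi big_cat.
Qed.

Lemma tlift_linear : linear (tlift f).
Proof.
move=> a; elim/tensorP=> s y; rewrite tliftD.
have -> : a *: \pi_tensor s = \pi_tensor [seq (a *: i.1, i.2) | i <- s].
  exact: tensor_scaleE.
rewrite !tlift_pi big_map scaler_sumr; congr (_ + _).
by apply: eq_bigr => -[v w] _ /=; rewrite bilinZl.
Qed.

End Lift.
End Tensor.

Notation "V ⊗ W" := (tensor V%type W%type) : type_scope.
Notation "v ⊗ w" := (tens v w) : ring_scope.

Section LinearSeparation.
Import classical_sets.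
Local Open Scope classical_set_scope.

Lemma ex_functional (k : fieldType) (V : lmodType k) (e : V) : e != 0 ->
  exists2 f : V -> k^o, linear f & f e = 1.
Proof.
move=> e0.
pose P (X : set V) :=
  (forall a u v, X u -> X v -> X (a *: u + v)) /\ ~ X e.
have [F FP Ftot|A [[AL Ae] Amax]] := @Zorn_bigcup _ P.
  split=> [a u v [X FX Xu] [Y FY Yv]|[X FX Xe]]; last by case: (FP X FX).
  have [XY|YX] := Ftot X Y FX FY.
    by exists Y => //; case: (FP Y FY) => YL _; apply: YL => //; apply: XY.
  by exists X => //; case: (FP X FX) => XL _; apply: XL => //; apply: YX.
have A0 : A 0.
  apply: contrapT => nA0; apply: (Amax [set 0]).
    split; last by move=> /(_ 0 erefl).
    move=> u Au; exfalso; apply: nA0.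
    by rewrite -[0](addNr u) -scaleN1r; apply: AL.
  split=> [a u v /= -> ->|/= e0']; first by rewrite scaler0 addr0.
  by rewrite e0' eqxx in e0.
have AZ a u : A u -> A (a *: u) by move=> Au; rewrite -[_ *: _]addr0; apply: AL.
have exc v : exists c : k, A (v - c *: e).
  apply: contrapT => nc.
  apply: (Amax [set w | exists a : k, A (w - a *: v)]).
    split; first by move=> u Au; exists 0; rewrite scale0r subr0.
    have Bv : exists a : k, A (v - a *: v) by exists 1; rewrite scale1r subrr.
    by move=> /(_ v Bv) Av; apply: nc; exists 0; rewrite scale0r subr0.
  split=> [a u w [b Ab] [c Ac]|[a Aa]].
    exists (a * b + c); rewrite scalerDl opprD addrACA -scalerA -scalerBr.
    exact: AL.
  have [a0|a0] := eqVneq a 0; first by apply: Ae; rewrite a0 scale0r subr0 in Aa.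
  apply: nc; exists a^-1; have := AZ (- a^-1) _ Aa.
  by rewrite scalerBr scalerA mulNr mulVf // !scaleNr scale1r opprK addrC.
have [f fP] := choice exc.
have f_uniq v c : A (v - c *: e) -> c = f v.
  move=> Ac; apply/eqP; rewrite -subr_eq0; apply/negP => /negP nz; apply: Ae.
  have : A ((v - f v *: e) - (v - c *: e)).
    by rewrite addrC -scaleN1r; apply: AL.
  rewrite opprB addrC addrA subrK -scalerBl => /(AZ (c - f v)^-1).
  by rewrite scalerA mulVf // scale1r.
exists f => [a u v|]; last by apply/esym/f_uniq; rewrite scale1r subrr.
apply/esym/f_uniq.
have -> : a *: u + v - (a *: (f u : k^o) + f v : k) *: e
         = a *: (u - f u *: e) + (v - f v *: e).
  by rewrite scalerDl opprD addrACA scalerBr scalerA.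
exact: AL.
Qed.

End LinearSeparation.

Section TensorMaps.
Variable k : fieldType.
Implicit Types U V W X : lmodType k.

Lemma bilin_tens V W : bilin (@tens k V W).
Proof.
by split=> [w a v v'|v a w w']; rewrite ?tensDl ?tensZl ?tensDr ?tensZr.
Qed.

Lemma eq_tens V W U (f g : V ⊗ W -> U) : linear f -> linear g ->
  (forall v w, f (v ⊗ w) = g (v ⊗ w)) -> f =1 g.
Proof.
move=> fL gL fg.
have f0 : f 0 = 0 by have := fL (-1) 0 0; rewrite scaler0 addr0 scaleN1r addNr.
have g0 : g 0 = 0 by have := gL (-1) 0 0; rewrite scaler0 addr0 scaleN1r addNr.
elim/tens_ind=> [|//|x y fx fy]; first by rewrite f0 g0.
by have := fL 1 x y; have := gL 1 x y; rewrite !scale1r => -> ->; rewrite fx fy.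
Qed.

(* f ⊗ g *)
Definition tmap V W V' W' (f : V -> V') (g : W -> W') : V ⊗ W -> V' ⊗ W' :=
  tlift (fun v w => f v ⊗ g w).

Lemma tmap_bilin V W V' W' (f : V -> V') (g : W -> W') :
  linear f -> linear g -> bilin (fun v w => f v ⊗ g w).
Proof.
move=> fL gL; split=> [w a v v'|v a w w'].
  by rewrite fL tensDl tensZl.
by rewrite gL tensDr tensZr.
Qed.

Definition tassoc U V W : (U ⊗ V) ⊗ W -> U ⊗ (V ⊗ W) :=
  tlift (fun x w => tlift (fun u v => u ⊗ (v ⊗ w)) x).

Definition tassoc' U V W : U ⊗ (V ⊗ W) -> (U ⊗ V) ⊗ W :=
  tlift (fun u x => tlift (fun v w => (u ⊗ v) ⊗ w) x).

End TensorMaps.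

Section TensorAlgebra.
Variables (k : fieldType) (A B : algType k).
Implicit Types x y z : A ⊗ B.

Definition tmul x y : A ⊗ B :=
  tlift (fun a b => tlift (fun a' b' => (a * a') ⊗ (b * b')) y) x.

Lemma tmul_bilin_in a b :
  bilin (fun (a' : A) (b' : B) => (a * a') ⊗ (b * b')).
Proof.
split=> [b' c u v|a' c u v].
  by rewrite mulrDr -scalerAr tensDl tensZl.
by rewrite mulrDr -scalerAr tensDr tensZr.
Qed.

Lemma tmul_bilin_out y : bilin
  (fun (a : A) (b : B) => tlift (fun a' b' => (a * a') ⊗ (b * b')) y).
Proof.
split=> [b c u v|a c u v].
  rewrite /tlift scaler_sumr -big_split; apply: eq_bigr => -[a' b'] _ /=.
  by rewrite mulrDl -scalerAl tensDl tensZl.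
rewrite /tlift scaler_sumr -big_split; apply: eq_bigr => -[a' b'] _ /=.
by rewrite mulrDl -scalerAl tensDr tensZr.
Qed.

Lemma tmul_tens a b a' b' : tmul (a ⊗ b) (a' ⊗ b') = (a * a') ⊗ (b * b').
Proof.
rewrite /tmul (tlift_tens (tmul_bilin_out _)).
exact: (tlift_tens (tmul_bilin_in _ _)).
Qed.

Lemma tmul_linl y : linear (tmul^~ y).
Proof. exact/tlift_linear/tmul_bilin_out. Qed.

Lemma tmul_linr x : linear (tmul x).
Proof.
move=> c u v; rewrite /tmul {1 3 4}/tlift scaler_sumr -big_split.
apply: eq_bigr => -[a b] _ /=.
exact: (tlift_linear (tmul_bilin_in a b)).
Qed.

Lemma tmul_bilin : bilin tmul.
Proof. by split=> [y|x]; [apply: tmul_linl|apply: tmul_linr]. Qed.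

Fact tmulDl : left_distributive tmul +%R.
Proof. by move=> x y z; rewrite (bilinDl tmul_bilin). Qed.
Fact tmulDr : right_distributive tmul +%R.
Proof. by move=> x y z; rewrite (bilinDr tmul_bilin). Qed.
Fact tmul0l x : tmul 0 x = 0. Proof. exact: (bilin0l tmul_bilin). Qed.
Fact tmul0r x : tmul x 0 = 0. Proof. exact: (bilin0r tmul_bilin). Qed.

Fact tmulA : associative tmul.
Proof.
elim/tens_ind=> [y z|a b|x x' IHx IHx' y z]; first by rewrite !tmul0l.
  elim/tens_ind=> [z|a' b'|y y' IHy IHy' z].
  - by rewrite !(tmul0l, tmul0r).
  - elim/tens_ind=> [|a'' b''|z z' IHz IHz']; first by rewrite !tmul0r.
      by rewrite !tmul_tens !mulrA.
    by rewrite !tmulDr IHz IHz'.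
  - by rewrite !(tmulDr, tmulDl) IHy IHy'.
by rewrite !tmulDl IHx IHx'.
Qed.

Fact tmul1l : left_id (1 ⊗ 1) tmul.
Proof.
elim/tens_ind=> [|a b|x y IHx IHy]; first by rewrite tmul0r.
  by rewrite tmul_tens !mul1r.
by rewrite tmulDr IHx IHy.
Qed.
Fact tmul1r : right_id (1 ⊗ 1) tmul.
Proof.
elim/tens_ind=> [|a b|x y IHx IHy]; first by rewrite tmul0l.
  by rewrite tmul_tens !mulr1.
by rewrite tmulDl IHx IHy.
Qed.

Fact tens1_neq0 : (1 : A) ⊗ (1 : B) != 0.
Proof.
have [f fL f1] := ex_functional (oner_neq0 A).
have [g gL g1] := ex_functional (oner_neq0 B).
have fgB : bilin (fun a b => f a * g b : k^o).
  split=> [b c u v|a c u v]; first by rewrite fL mulrDl scalerAl.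
  by rewrite gL mulrDr scalerAr.
apply/eqP => /(congr1 (tlift (fun a b => f a * g b : k^o))).
rewrite tlift_tens // f1 g1 mulr1 -[X in tlift _ X](scale0r 0).
rewrite -[0 *: _]addr0 (tlift_linear fgB) scale0r add0r.
have -> : (0 : A ⊗ B) = 0 ⊗ 0 by rewrite -[0 in RHS](scale0r 0) tensZl scale0r.
rewrite tlift_tens // -[X in f X](scale0r 0) -[X in f X]addr0 fL scale0r add0r.
have f0 : f 0 = 0 by have := fL (-1) 0 0; rewrite scaler0 addr0 scaleN1r addNr.
by rewrite f0 mul0r => /eqP; rewrite oner_eq0.
Qed.

HB.instance Definition _ := GRing.Zmodule_isNzRing.Build (A ⊗ B)%type
  tmulA tmul1l tmul1r tmulDl tmulDr tens1_neq0.

Lemma tensM (a a' : A) (b b' : B) :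
  (a ⊗ b) * (a' ⊗ b') = (a * a') ⊗ (b * b').
Proof. exact: tmul_tens. Qed.

Fact tmulZl c x y : c *: (x * y) = (c *: x) * y.
Proof. exact/esym/(bilinZl tmul_bilin). Qed.
HB.instance Definition _ := GRing.Lmodule_isLalgebra.Build k (A ⊗ B)%type tmulZl.
Fact tmulZr c x y : c *: (x * y) = x * (c *: y).
Proof. exact/esym/(bilinZr tmul_bilin). Qed.
HB.instance Definition _ := GRing.Lalgebra_isAlgebra.Build k (A ⊗ B)%type tmulZr.

End TensorAlgebra.

HB.mixin Record isHopf (k : fieldType) H of GRing.Algebra k H := {
  comul_def : {lrmorphism H -> H ⊗ H};
  counit_def : {lrmorphism H -> k^o};
  antipode_def : {linear H -> H};
  comulA_def : forall h, tassoc (tmap comul_def idfun (comul_def h)) =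
                         tmap idfun comul_def (comul_def h);
  comul1l_def : forall h, tlift (fun x y => counit_def x *: y) (comul_def h) = h;
  comul1r_def : forall h, tlift (fun x y => counit_def y *: x) (comul_def h) = h;
  antipodel_def : forall h,
    tlift (fun x y => antipode_def x * y) (comul_def h) = (counit_def h : k) *: 1;
  antipoder_def : forall h,
    tlift (fun x y => x * antipode_def y) (comul_def h) = (counit_def h : k) *: 1
}.

#[short(type="hopfAlgType")]
HB.structure Definition Hopf (k : fieldType) :=
  {H of GRing.Algebra k H & isHopf k H}.

#[short(type="fdHopfAlgType")]
HB.structure Definition FdHopf (k : fieldType) :=
  {H of Hopf k H & Vector k H}.

Section HopfOps.
Variables (k : fieldType) (H : hopfAlgType k).

Definition comul : {lrmorphism H -> H ⊗ H} := comul_def.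
Definition counit : {lrmorphism H -> k^o} := counit_def.
Definition antipode : {linear H -> H} := antipode_def.

End HopfOps.

Arguments comul {k H}.
Arguments counit {k H}.
Arguments antipode {k H}.

Section HopfAxioms.
Variables (k : fieldType) (H : hopfAlgType k).
Implicit Types h x y : H.

Lemma comulA h : tassoc (tmap comul idfun (comul h)) = tmap idfun comul (comul h).
Proof. exact: comulA_def. Qed.
Lemma comul1l h : tlift (fun x y : H => (counit x : k) *: y) (comul h) = h.
Proof. exact: comul1l_def. Qed.
Lemma comul1r h : tlift (fun x y : H => (counit y : k) *: x) (comul h) = h.
Proof. exact: comul1r_def. Qed.
Lemma antipodel h : tlift (fun x y : H => antipode x * y) (comul h) = (counit h : k) *: 1.
Proof. exact: antipodel_def. Qed.
Lemma antipoder h : tlift (fun x y : H => x * antipode y) (comul h) = (counit h : k) *: 1.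
Proof. exact: antipoder_def. Qed.

End HopfAxioms.

Section LiftTheory.
Variable k : fieldType.
Implicit Types U V W X : lmodType k.

Lemma linear_tlift U U' V W (F : U -> U') (g : V -> W -> U) (x : V ⊗ W) :
  linear F -> F (tlift g x) = tlift (fun v w => F (g v w)) x.
Proof.
move=> FL.
have F0 : F 0 = 0 by have := FL (-1) 0 0; rewrite scaler0 addr0 scaleN1r addNr.
have FD u v : F (u + v) = F u + F v by have := FL 1 u v; rewrite !scale1r.
exact: (big_morph F FD F0).
Qed.

Lemma tlift_param_linear X U V W (f : X -> V -> W -> U) (x : V ⊗ W) :
  (forall v w, linear (fun t => f t v w)) -> linear (fun t => tlift (f t) x).
Proof.
move=> fL a s t; rewrite /tlift scaler_sumr -big_split.
by apply: eq_bigr => i _; rewrite fL.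
Qed.

Lemma eq_tlift U V W (f g : V -> W -> U) (x : V ⊗ W) :
  (forall v w, f v w = g v w) -> tlift f x = tlift g x.
Proof. by move=> fg; apply: eq_bigr => i _. Qed.

Lemma tlift_exchange U V W V' W' (f : V -> W -> V' -> W' -> U)
    (x : V ⊗ W) (y : V' ⊗ W') :
  tlift (fun v w => tlift (f v w) y) x =
  tlift (fun v' w' => tlift (fun v w => f v w v' w') x) y.
Proof. exact: exchange_big. Qed.

Lemma tlift_sum U V W I (r : seq I) (f : V -> W -> U) (g : I -> V ⊗ W) :
  bilin f -> tlift f (\sum_(i <- r) g i) = \sum_(i <- r) tlift f (g i).
Proof.
move=> fB; apply: (big_morph _ (tliftD fB)).
by have := tlift_linear fB (-1) 0 0; rewrite scaler0 addr0 scaleN1r addNr.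
Qed.

Lemma tlift_linear_comp U V W X (f : V -> W -> U) (F : X -> V ⊗ W) :
  bilin f -> linear F -> linear (fun t => tlift f (F t)).
Proof. by move=> fB FL a s t; rewrite FL tlift_linear. Qed.

Definition trilin V W X U (f : V -> W -> X -> U) :=
  [/\ forall w x, linear (fun v => f v w x), forall v x, linear (fun w => f v w x)
    & forall v w, linear (f v w)].

End LiftTheory.

Section HopfTheory.
Variables (k : fieldType) (H : hopfAlgType k).

Lemma comulA_lift (U : lmodType k) (f : H -> H -> H -> U) (h : H) : trilin f ->
  tlift (fun x z => tlift (fun u v => f u v z) (comul x)) (comul h) =
  tlift (fun x z => tlift (fun u v => f x u v) (comul z)) (comul h).
Proof.
move=> [f1 f2 f3].
pose F : H ⊗ (H ⊗ H) -> U := tlift (fun x z => tlift (f x) z).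
have fB x : bilin (f x) by split.
have FB : bilin (fun x (z : H ⊗ H) => tlift (f x) z).
  by split=> [z|x]; [apply: tlift_param_linear|apply: tlift_linear].
have FL : linear F by apply: tlift_linear.
transitivity (F (tmap idfun comul (comul h))); last first.
  rewrite /tmap (linear_tlift _ _ FL); apply: eq_tlift => x z.
  exact: tlift_tens.
rewrite -comulA /tassoc (linear_tlift _ _ FL) /tmap.
pose G (x : H ⊗ H) (w : H) := F (tlift (fun u v : H => u ⊗ (v ⊗ w)) x).
have tB (w : H) : bilin (fun u v : H => u ⊗ (v ⊗ w)).
  split=> [v|u] a x y; first by rewrite (bilin_tens _ _).1.
  by rewrite tensDl tensZl tensDr tensZr.
have GB : bilin G.
  split=> [w|x] a u v; first by rewrite /G (tlift_linear (tB _)) FL.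
  rewrite /G -FL; congr F; move: a u v.
  apply: (tlift_param_linear (f := fun w u v : H => u ⊗ (v ⊗ w))) => u v b w w'.
  by rewrite !(tensDr, tensZr).
rewrite -/G (linear_tlift _ _ (tlift_linear GB)); apply: eq_tlift => x z.
rewrite (tlift_tens GB) /G (linear_tlift _ _ FL); apply: eq_tlift => u v.
by rewrite /F (tlift_tens FB) (tlift_tens (fB _)).
Qed.

End HopfTheory.

Section Dual.
Variables (k : fieldType) (L : fdHopfAlgType k).

(* The linear dual L^*, with the algebra structure dual to the coalgebra L. *)
Definition dual : predArgType := 'Hom(L, k^o).
HB.instance Definition _ := Vector.on dual.

Implicit Types f g : dual.

Definition mkdual (F : L -> k^o) : dual := linfun F.

Lemma mkdualE (F : L -> k^o) : linear F -> mkdual F =1 F.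
Proof.
move=> FL; pose m := GRing.isLinear.Build k L k^o _ F FL.
pose F' : {linear L -> k^o} := HB.pack F m.
exact: (lfunE F').
Qed.

Lemma dual_linear f : linear (f : L -> k^o).
Proof. exact: linearP. Qed.

Lemma dualP f g : (forall h, f h = g h) <-> f = g.
Proof. by split=> [fg|-> //]; apply/lfunP. Qed.

Lemma dualD f g h : (f + g) h = f h + g h. Proof. exact: add_lfunE. Qed.
Lemma dualZ a f h : (a *: f) h = a * f h. Proof. exact: scale_lfunE. Qed.

Lemma dual_linE f a u v : f (a *: u + v) = a * f u + f v.
Proof. exact: dual_linear. Qed.

Lemma dual_bilin f g : bilin (fun x y : L => f x * g y : k^o).
Proof.
split=> [y|x] a u v; first by rewrite linearP mulrDl -scalerAl.
by rewrite linearP mulrDr -scalerAr.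
Qed.

Definition dual_mul f g : dual :=
  mkdual (fun h => tlift (fun x y => f x * g y : k^o) (comul h)).
Definition dual_one : dual := mkdual (fun h => counit h).

Lemma dual_mulE f g h :
  dual_mul f g h = tlift (fun x y => f x * g y : k^o) (comul h).
Proof.
rewrite mkdualE //; apply: tlift_linear_comp; first exact: dual_bilin.
exact: linearP.
Qed.

Lemma dual_oneE h : dual_one h = counit h.
Proof. by rewrite mkdualE //; apply: linearP. Qed.

Fact dual_mulA : associative dual_mul.
Proof.
move=> f g e; apply/dualP => h.
rewrite !dual_mulE.
pose T (x y z : L) : k^o := f x * g y * e z.
have TT : trilin T.
  split=> [y z|x z|x y] a u v; rewrite /T dual_linE -[a *: _]/(a * _).
  - by rewrite !mulrDl !mulrA.
  - by rewrite mulrDr mulrDl !mulrA [f x * a]mulrC.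
  - by rewrite mulrDr !mulrA [f x * g y * a]mulrC mulrA.
transitivity (tlift (fun x z => tlift (fun u v => T x u v) (comul z)) (comul h)).
  apply: eq_tlift => x z; rewrite dual_mulE /tlift mulr_sumr.
  by apply: eq_bigr => i _; rewrite /T mulrA.
rewrite -(comulA_lift _ TT); apply: eq_tlift => x z.
by rewrite dual_mulE /tlift mulr_suml.
Qed.
Fact dual_mul1l : left_id dual_one dual_mul.
Proof.
move=> f; apply/dualP => h; rewrite dual_mulE -[in RHS](comul1l h).
rewrite (linear_tlift _ _ (dual_linear f)); apply: eq_tlift => x y.
by rewrite dual_oneE linearZ.
Qed.
Fact dual_mul1r : right_id dual_one dual_mul.
Proof.
move=> f; apply/dualP => h; rewrite dual_mulE -[in RHS](comul1r h).
rewrite (linear_tlift _ _ (dual_linear f)); apply: eq_tlift => x y.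
by rewrite dual_oneE linearZ mulrC.
Qed.
Fact dual_mulDl : left_distributive dual_mul +%R.
Proof.
move=> f g e; apply/dualP => h; rewrite dualD !dual_mulE /tlift -big_split.
by apply: eq_bigr => i _; rewrite dualD mulrDl.
Qed.
Fact dual_mulDr : right_distributive dual_mul +%R.
Proof.
move=> f g e; apply/dualP => h; rewrite dualD !dual_mulE /tlift -big_split.
by apply: eq_bigr => i _; rewrite dualD mulrDr.
Qed.
Fact dual_one_neq0 : dual_one != 0.
Proof.
apply/eqP => /dualP /(_ 1); rewrite dual_oneE rmorph1 lfunE /= => /eqP.
by rewrite oner_eq0.
Qed.

HB.instance Definition _ := GRing.Zmodule_isNzRing.Build dual
  dual_mulA dual_mul1l dual_mul1r dual_mulDl dual_mulDr dual_one_neq0.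

Fact dual_mulZl (a : k) f g : a *: (f * g) = (a *: f) * g.
Proof.
apply/dualP => h; rewrite dualZ !dual_mulE /tlift mulr_sumr.
by apply: eq_bigr => i _; rewrite dualZ mulrA.
Qed.
HB.instance Definition _ := GRing.Lmodule_isLalgebra.Build k dual dual_mulZl.
Fact dual_mulZr (a : k) f g : a *: (f * g) = f * (a *: g).
Proof.
apply/dualP => h; rewrite dualZ !dual_mulE /tlift mulr_sumr.
by apply: eq_bigr => i _; rewrite dualZ mulrCA.
Qed.
HB.instance Definition _ := GRing.Lalgebra_isAlgebra.Build k dual dual_mulZr.

Lemma dualM f g h : (f * g) h = tlift (fun x y => f x * g y : k^o) (comul h).
Proof. exact: dual_mulE. Qed.
Lemma dual1 h : (1 : dual) h = counit h.
Proof. exact: dual_oneE. Qed.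

(* h ⇀ f = \sum f_2(h) f_1 is the functional l |-> f (l * h), because the
   coproduct of L^* is determined by f (l * h) = \sum f_1(l) f_2(h). *)
Definition hit (h : L) f : dual := mkdual (fun l => f (l * h)).

Lemma hitE h f l : hit h f l = f (l * h).
Proof.
by rewrite mkdualE // => a u v; rewrite mulrDl -scalerAl linearP.
Qed.

Lemma hit_bilin : bilin hit.
Proof.
split=> [f|h] a u v; apply/dualP => l.
  by rewrite dualD dualZ !hitE mulrDr -scalerAr linearP.
by rewrite dualD dualZ !hitE dualD dualZ.
Qed.

Lemma hit1 f : hit 1 f = f.
Proof. by apply/dualP => l; rewrite hitE mulr1. Qed.

Lemma hitM h h' f : hit (h * h') f = hit h (hit h' f).
Proof. by apply/dualP => l; rewrite !hitE mulrA. Qed.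

Lemma hit_one h : hit h 1 = (counit h : k) *: 1.
Proof. by apply/dualP => l; rewrite hitE dualZ !dual1 rmorphM mulrC. Qed.

Lemma tmul_tliftE (A B : algType k) (U : lmodType k) (f : A -> B -> U)
    (x y : A ⊗ B) : bilin f ->
  tlift f (x * y) =
  tlift (fun a b => tlift (fun a' b' => f (a * a') (b * b')) y) x.
Proof.
move=> fB.
rewrite -[x * y]/(tmul x y) /tmul (linear_tlift _ _ (tlift_linear fB)).
apply: eq_tlift => a b; rewrite (linear_tlift _ _ (tlift_linear fB)).
by apply: eq_tlift => a' b'; rewrite (tlift_tens fB).
Qed.

Lemma hit_mul h f g :
  hit h (f * g) = tlift (fun x y => hit x f * hit y g) (comul h).
Proof.
apply/dualP => l; rewrite hitE dualM rmorphM (tmul_tliftE _ _ (dual_bilin _ _)).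
have evL : linear (fun e : dual => e l : k^o).
  by move=> a u v; rewrite dualD dualZ.
rewrite (linear_tlift _ _ evL) tlift_exchange; apply: eq_tlift => x y.
by rewrite dualM; apply: eq_tlift => u v; rewrite !hitE.
Qed.

End Dual.

Section Heisenberg.
Variables (k : fieldType) (L : fdHopfAlgType k).
Implicit Types (a b c : dual L) (h l m : L).

(* The Heisenberg double L^* # L: the space L^* ⊗ L, where a ⊗ h stands for
   a # h, with the smash product multiplication. *)
Definition heisenberg : predArgType := (dual L ⊗ L)%type.
HB.instance Definition _ := GRing.Lmodule.on heisenberg.

Implicit Types x y z : heisenberg.

Definition smash2 a h b l : heisenberg :=
  tlift (fun h1 h2 => (a * hit h1 b) ⊗ (h2 * l)) (comul h).

Definition smash_mul x y : heisenberg :=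
  tlift (fun a h => tlift (fun b l => smash2 a h b l) y) x.

Lemma smash2_in_bilin a b l : bilin (fun h1 h2 : L => (a * hit h1 b) ⊗ (h2 * l)).
Proof.
split=> [h2|h1] t u v.
  by rewrite (bilinDl (@hit_bilin _ L)) (bilinZl (@hit_bilin _ L)) mulrDr -scalerAr
     tensDl tensZl.
by rewrite mulrDl -scalerAl tensDr tensZr.
Qed.

Lemma smash2_linear1 h b l : linear (fun a => smash2 a h b l).
Proof.
apply: tlift_param_linear => h1 h2 t u v.
by rewrite mulrDl -scalerAl tensDl tensZl.
Qed.
Lemma smash2_linear2 a b l : linear (fun h => smash2 a h b l).
Proof.
move=> t u v; rewrite /smash2 linearP.
exact: (tlift_linear (smash2_in_bilin _ _ _)).
Qed.
Lemma smash2_linear3 a h l : linear (fun b => smash2 a h b l).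
Proof.
apply: tlift_param_linear => h1 h2 t u v.
by rewrite (bilinDr (@hit_bilin _ L)) (bilinZr (@hit_bilin _ L)) mulrDr -scalerAr
     tensDl tensZl.
Qed.
Lemma smash2_linear4 a h b : linear (fun l => smash2 a h b l).
Proof.
apply: tlift_param_linear => h1 h2 t u v.
by rewrite mulrDr -scalerAr tensDr tensZr.
Qed.

Lemma smash2_bilin a h : bilin (smash2 a h).
Proof. by split=> [l|b]; [apply: smash2_linear3|apply: smash2_linear4]. Qed.

Lemma smash_mul_bilin_out y : bilin (fun a h => tlift (fun b l => smash2 a h b l) y).
Proof.
split=> [h|a]; apply: tlift_param_linear => b l.
  exact: smash2_linear1.
exact: smash2_linear2.
Qed.

Lemma smash_mul_bilin : bilin smash_mul.
Proof.
split=> [y|x]; first exact/tlift_linear/smash_mul_bilin_out.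
move=> t u v; rewrite /smash_mul {1 3 4}/tlift scaler_sumr -big_split.
by apply: eq_bigr => i _; rewrite (tlift_linear (smash2_bilin _ _)).
Qed.

Lemma smash_mul_tens a h b l : smash_mul (a ⊗ h) (b ⊗ l) = smash2 a h b l.
Proof.
by rewrite /smash_mul (tlift_tens (smash_mul_bilin_out _)) (tlift_tens (smash2_bilin _ _)).
Qed.

Lemma smash_mulA_tens a h b l c m :
  smash_mul (smash_mul (a ⊗ h) (b ⊗ l)) (c ⊗ m) =
  smash_mul (a ⊗ h) (smash_mul (b ⊗ l) (c ⊗ m)).
Proof.
have mulL y : linear (fun x => smash_mul x y) by apply: smash_mul_bilin.1.
have mulR x : linear (smash_mul x) by apply: smash_mul_bilin.2.
rewrite !smash_mul_tens /smash2 (linear_tlift _ _ (mulL _)) (linear_tlift _ _ (mulR _)).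
pose T p q : L -> L -> L -> heisenberg := fun u v w =>
  (a * (hit u b * hit v (hit p c))) ⊗ (w * (q * m)).
have TT p q : trilin (T p q).
  split=> [v w|u w|u v] t x y; rewrite /T.
  - by rewrite (bilinDl (@hit_bilin _ L)) (bilinZl (@hit_bilin _ L)) mulrDl mulrDr
       -scalerAl -scalerAr tensDl tensZl.
  - by rewrite (bilinDl (@hit_bilin _ L)) (bilinZl (@hit_bilin _ L)) !mulrDr
       -!scalerAr tensDl tensZl.
  - by rewrite mulrDl -scalerAl tensDr tensZr.
transitivity (tlift (fun x z : L => tlift (fun v w => tlift (fun p q =>
    T p q x v w) (comul l)) (comul z)) (comul h)).
  apply: eq_tlift => x z; rewrite smash_mul_tens /smash2 rmorphM.
  rewrite (tmul_tliftE _ _ (smash2_in_bilin _ _ _)); apply: eq_tlift => v w.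
  by apply: eq_tlift => p q; rewrite /T hitM !mulrA.
transitivity (tlift (fun p q => tlift (fun x z : L => tlift (fun v w =>
    T p q x v w) (comul z)) (comul h)) (comul l)).
  rewrite tlift_exchange; apply: eq_tlift => x z.
  by rewrite tlift_exchange; apply: eq_tlift.
apply: eq_tlift => p q; rewrite -(comulA_lift _ (TT p q)) smash_mul_tens /smash2.
apply: eq_tlift => x z; rewrite hit_mul.
have FL : linear (fun e : dual L => (a * e) ⊗ (z * (q * m)) : heisenberg).
  by move=> t u v; rewrite mulrDr -scalerAr tensDl tensZl.
by rewrite (linear_tlift _ _ FL).
Qed.

Fact smash_mulDl : left_distributive smash_mul +%R.
Proof. by move=> x y z; rewrite (bilinDl smash_mul_bilin). Qed.
Fact smash_mulDr : right_distributive smash_mul +%R.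
Proof. by move=> x y z; rewrite (bilinDr smash_mul_bilin). Qed.
Fact smash_mul0l x : smash_mul 0 x = 0. Proof. exact: (bilin0l smash_mul_bilin). Qed.
Fact smash_mul0r x : smash_mul x 0 = 0. Proof. exact: (bilin0r smash_mul_bilin). Qed.

Fact smash_mulA : associative smash_mul.
Proof.
elim/tens_ind=> [y z|a h|x x' IHx IHx' y z]; first by rewrite !smash_mul0l.
  elim/tens_ind=> [z|b l|y y' IHy IHy' z].
  - by rewrite !(smash_mul0l, smash_mul0r).
  - elim/tens_ind=> [|c m|z z' IHz IHz']; first by rewrite !smash_mul0r.
      by rewrite smash_mulA_tens.
    by rewrite !smash_mulDr IHz IHz'.
  - by rewrite !(smash_mulDr, smash_mulDl) IHy IHy'.
by rewrite !smash_mulDl IHx IHx'.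
Qed.

Fact smash_mul1l : left_id ((1 : dual L) ⊗ (1 : L)) smash_mul.
Proof.
elim/tens_ind=> [|a h|x y IHx IHy]; first by rewrite smash_mul0r.
  rewrite smash_mul_tens /smash2 rmorph1.
  by rewrite (tlift_tens (smash2_in_bilin _ _ _)) hit1 !mul1r.
by rewrite smash_mulDr IHx IHy.
Qed.
Fact smash_mul1r : right_id ((1 : dual L) ⊗ (1 : L)) smash_mul.
Proof.
elim/tens_ind=> [|a h|x y IHx IHy]; first by rewrite smash_mul0l.
  rewrite smash_mul_tens /smash2 -[in RHS](comul1l h).
  have tL : linear (fun h : L => a ⊗ h : heisenberg).
    by move=> t u v; rewrite tensDr tensZr.
  rewrite (linear_tlift _ _ tL); apply: eq_tlift => u v.
  by rewrite hit_one mulr1 -scalerAr mulr1 tensZl tensZr.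
by rewrite smash_mulDl IHx IHy.
Qed.

HB.instance Definition _ := GRing.Zmodule_isNzRing.Build heisenberg
  smash_mulA smash_mul1l smash_mul1r smash_mulDl smash_mulDr (tens1_neq0 _ _).

Fact smash_mulZl (t : k) x y : t *: (x * y) = (t *: x : heisenberg) * y.
Proof. exact: (esym (bilinZl smash_mul_bilin t x y)). Qed.
HB.instance Definition _ := GRing.Lmodule_isLalgebra.Build k heisenberg smash_mulZl.
Fact smash_mulZr (t : k) x y : t *: (x * y) = x * (t *: y : heisenberg).
Proof. exact: (esym (bilinZr smash_mul_bilin t x y)). Qed.
HB.instance Definition _ := GRing.Lalgebra_isAlgebra.Build k heisenberg smash_mulZr.

Lemma smashM a h b l :
  (a ⊗ h : heisenberg) * (b ⊗ l : heisenberg) =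
  tlift (fun h1 h2 => (a * hit h1 b) ⊗ (h2 * l)) (comul h).
Proof. exact: smash_mul_tens. Qed.

End Heisenberg.

Section GroupAlgebra.
Variables (k : fieldType) (gT : finGroupType).

(* The group algebra k[gT]: the function f stands for \sum_g f g *: g. *)
Definition groupAlg : predArgType := {ffun gT -> k^o}.
HB.instance Definition _ := Vector.on groupAlg.

Implicit Types f g : groupAlg.

Definition gelt (x : gT) : groupAlg := [ffun y => (y == x)%:R : k].

(* Linear extension of a map defined on the group. *)
Definition gext (V : lmodType k) (F : gT -> V) f : V := \sum_x (f x : k) *: F x.

Lemma gext_linear (V : lmodType k) (F : gT -> V) : linear (gext F).
Proof.
move=> a f g; rewrite /gext scaler_sumr -big_split; apply: eq_bigr => x _ /=.
by rewrite !ffunE scalerDl scalerA.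
Qed.

Lemma gext_gelt (V : lmodType k) (F : gT -> V) x : gext F (gelt x) = F x.
Proof.
rewrite /gext (bigD1 x) //= big1 => [|y yx]; rewrite ffunE ?eqxx ?scale1r ?addr0 //.
by rewrite (negPf yx) scale0r.
Qed.

Lemma groupAlgE f : f = gext gelt f.
Proof.
apply/ffunP => x; rewrite sum_ffunE (bigD1 x) //= big1 => [|y yx].
  by rewrite !ffunE eqxx addr0 /GRing.scale /= mulr1.
by rewrite !ffunE eq_sym (negPf yx) /GRing.scale /= mulr0.
Qed.

Lemma eq_gext (V : lmodType k) (F G : groupAlg -> V) : linear F -> linear G ->
  (forall x, F (gelt x) = G (gelt x)) -> F =1 G.
Proof.
move=> FL GL FG f.
have red (E : groupAlg -> V) : linear E -> E f = \sum_x (f x : k) *: E (gelt x).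
  move=> EL; rewrite {1}(groupAlgE f) /gext.
  have E0 : E 0 = 0 by have := EL (-1) 0 0; rewrite scaler0 addr0 scaleN1r addNr.
  rewrite (big_morph E (_ : {morph E : u v / u + v}) E0).
    apply: eq_bigr => x _.
    by have := EL (f x) (gelt x) 0; rewrite E0 !addr0.
  by move=> u v; have := EL 1 u v; rewrite !scale1r.
by rewrite (red F) // (red G) //; apply: eq_bigr => x _; rewrite FG.
Qed.

Definition gmul f g : groupAlg :=
  gext (fun x => gext (fun y => gelt (x * y)%g) g) f.

Lemma gmul_bilin : bilin gmul.
Proof.
split=> [g|f]; first exact: gext_linear.
move=> a u v; rewrite /gmul {1 3 5}/gext scaler_sumr -big_split.
apply: eq_bigr => x _ /=; rewrite gext_linear scalerDr !scalerA.
by rewrite mulrC.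
Qed.

Lemma gmul_gelt x y : gmul (gelt x) (gelt y) = gelt (x * y)%g.
Proof. by rewrite /gmul !gext_gelt. Qed.

Fact gmulA : associative gmul.
Proof.
have B := gmul_bilin.
move=> f g h; move: f; apply: eq_gext => [a u v|a u v|x].
- by rewrite B.1.
- by rewrite B.1 B.1.
move: g; apply: eq_gext => [a u v|a u v|y].
- by rewrite B.1 B.2.
- by rewrite B.2 B.1.
move: h; apply: eq_gext => [a u v|a u v|z].
- by rewrite !B.2.
- by rewrite !B.2.
by rewrite !gmul_gelt mulgA.
Qed.
Fact gmul1l : left_id (gelt 1%g) gmul.
Proof.
apply: eq_gext => [|//|x]; first exact: gmul_bilin.2.
by rewrite gmul_gelt mul1g.
Qed.
Fact gmul1r : right_id (gelt 1%g) gmul.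
Proof.
apply: eq_gext => [|//|x]; first exact: gmul_bilin.1.
by rewrite gmul_gelt mulg1.
Qed.
Fact gmulDl : left_distributive gmul +%R.
Proof. by move=> x y z; rewrite (bilinDl gmul_bilin). Qed.
Fact gmulDr : right_distributive gmul +%R.
Proof. by move=> x y z; rewrite (bilinDr gmul_bilin). Qed.
Fact gelt1_neq0 : gelt 1%g != 0.
Proof.
by apply/eqP => /ffunP /(_ 1%g) /eqP; rewrite !ffunE eqxx oner_eq0.
Qed.

HB.instance Definition _ := GRing.Zmodule_isNzRing.Build groupAlg
  gmulA gmul1l gmul1r gmulDl gmulDr gelt1_neq0.

Fact gmulZl (a : k) f g : a *: (f * g) = (a *: f : groupAlg) * g.
Proof. exact/esym/(bilinZl gmul_bilin). Qed.
HB.instance Definition _ := GRing.Lmodule_isLalgebra.Build k groupAlg gmulZl.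
Fact gmulZr (a : k) f g : a *: (f * g) = f * (a *: g : groupAlg).
Proof. exact/esym/(bilinZr gmul_bilin). Qed.
HB.instance Definition _ := GRing.Lalgebra_isAlgebra.Build k groupAlg gmulZr.

Lemma geltM x y : gelt x * gelt y = gelt (x * y)%g. Proof. exact: gmul_gelt. Qed.
Lemma gelt1 : gelt 1%g = 1. Proof. by []. Qed.

Lemma gext_monoid_morphism (A : algType k) (F : gT -> A) :
  F 1%g = 1 -> {morph F : x y / (x * y)%g >-> x * y} -> monoid_morphism (gext F).
Proof.
move=> F1 FM; split; first by rewrite -gelt1 gext_gelt.
move=> f g; move: f; apply: eq_gext => [a u v|a u v|x].
- by rewrite mulrDl -scalerAl gext_linear.
- by rewrite gext_linear mulrDl -scalerAl.
move: g; apply: eq_gext => [a u v|a u v|y].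
- by rewrite mulrDr -scalerAr gext_linear.
- by rewrite gext_linear mulrDr -scalerAr.
by rewrite geltM !gext_gelt.
Qed.

Definition gcomul : groupAlg -> groupAlg ⊗ groupAlg := gext (fun x => gelt x ⊗ gelt x).
Definition gcounit : groupAlg -> k^o := gext (fun=> 1 : k^o).
Definition gantipode : groupAlg -> groupAlg := gext (fun x => gelt x^-1%g).

Fact gcomul_monoid_morphism : monoid_morphism gcomul.
Proof. by apply: gext_monoid_morphism => // x y; rewrite tensM geltM. Qed.
Fact gcounit_monoid_morphism : monoid_morphism gcounit.
Proof. by apply: gext_monoid_morphism => // x y; rewrite mulr1. Qed.

HB.instance Definition _ := GRing.isLinear.Build k groupAlg (groupAlg ⊗ groupAlg)%type
  _ gcomul (gext_linear _).
HB.instance Definition _ := GRing.isMonoidMorphism.Build groupAlg (groupAlg ⊗ groupAlg)%type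
  gcomul gcomul_monoid_morphism.
HB.instance Definition _ := GRing.isLinear.Build k groupAlg k^o
  _ gcounit (gext_linear _).
HB.instance Definition _ := GRing.isMonoidMorphism.Build groupAlg k^o
  gcounit gcounit_monoid_morphism.
HB.instance Definition _ := GRing.isLinear.Build k groupAlg groupAlg
  _ gantipode (gext_linear _).

Lemma gcomul_gelt x : gcomul (gelt x) = gelt x ⊗ gelt x.
Proof. exact: gext_gelt. Qed.
Lemma gcounit_gelt x : gcounit (gelt x) = 1.
Proof. exact: gext_gelt. Qed.
Lemma gantipode_gelt x : gantipode (gelt x) = gelt x^-1%g.
Proof. exact: gext_gelt. Qed.

End GroupAlgebra.

Section GroupHopf.
Variables (k : fieldType) (gT : finGroupType).
Local Notation kG := (groupAlg k gT).
Local Notation gcomul := (@gcomul k gT).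
Local Notation gcounit := (@gcounit k gT).
Local Notation gantipode := (@gantipode k gT).

Let gcomulL : linear gcomul. Proof. exact: gext_linear. Qed.
Let gcounitL : linear gcounit. Proof. exact: gext_linear. Qed.
Let gantipodeL : linear gantipode. Proof. exact: gext_linear. Qed.

Fact gcomulA (h : kG) :
  tassoc (tmap gcomul idfun (gcomul h)) = tmap idfun gcomul (gcomul h).
Proof.
have idL : linear (@idfun kG) by [].
have t1 := tmap_bilin gcomulL idL; have t2 := tmap_bilin idL gcomulL.
have t3 (w : kG) : bilin (fun u v : kG => u ⊗ (v ⊗ w)).
  by split=> [v|u] a x y; rewrite !(tensDl, tensDr) !(tensZl, tensZr) ?tensDr ?tensZr.
have t4 : bilin (fun (x : kG ⊗ kG) (w : kG) => tlift (fun u v => u ⊗ (v ⊗ w)) x).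
  split=> [w|x]; first exact: tlift_linear.
  apply: (tlift_param_linear (f := fun w u v : kG => u ⊗ (v ⊗ w))) => u v b w w'.
  by rewrite !(tensDr, tensZr).
move: h; apply: eq_gext => [a u v|a u v|x].
- by rewrite gcomulL /tmap (tlift_linear t1) /tassoc (tlift_linear t4).
- by rewrite gcomulL /tmap (tlift_linear t2).
rewrite !gcomul_gelt /tmap (tlift_tens t1) (tlift_tens t2) /= gcomul_gelt.
by rewrite /tassoc (tlift_tens t4) (tlift_tens (t3 _)).
Qed.

Fact gcomul1l (h : kG) : tlift (fun x y => (gcounit x : k) *: y) (gcomul h) = h.
Proof.
have B : bilin (fun x y : kG => (gcounit x : k) *: y).
  split=> [y|x] a u v; first by rewrite gcounitL scalerDl scalerA.
  by rewrite scalerDr !scalerA mulrC.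
move: h; apply: eq_gext => [a u v|//|x].
  by rewrite gcomulL (tlift_linear B).
by rewrite gcomul_gelt (tlift_tens B) /= gcounit_gelt scale1r.
Qed.

Fact gcomul1r (h : kG) : tlift (fun x y => (gcounit y : k) *: x) (gcomul h) = h.
Proof.
have B : bilin (fun x y : kG => (gcounit y : k) *: x).
  split=> [y|x] a u v; last by rewrite gcounitL scalerDl scalerA.
  by rewrite scalerDr !scalerA mulrC.
move: h; apply: eq_gext => [a u v|//|x].
  by rewrite gcomulL (tlift_linear B).
by rewrite gcomul_gelt (tlift_tens B) /= gcounit_gelt scale1r.
Qed.

Fact gantipodel (h : kG) :
  tlift (fun x y => gantipode x * y) (gcomul h) = (gcounit h : k) *: 1.
Proof.
have B : bilin (fun x y : kG => gantipode x * y).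
  split=> [y|x] a u v; first by rewrite gantipodeL mulrDl -scalerAl.
  by rewrite mulrDr -scalerAr.
move: h; apply: eq_gext => [a u v|a u v|x].
- by rewrite gcomulL (tlift_linear B).
- by rewrite gcounitL scalerDl scalerA.
rewrite gcomul_gelt (tlift_tens B) /= gcounit_gelt gantipode_gelt geltM mulVg.
by rewrite gelt1 scale1r.
Qed.

Fact gantipoder (h : kG) :
  tlift (fun x y => x * gantipode y) (gcomul h) = (gcounit h : k) *: 1.
Proof.
have B : bilin (fun x y : kG => x * gantipode y).
  split=> [y|x] a u v; last by rewrite gantipodeL mulrDr -scalerAr.
  by rewrite mulrDl -scalerAl.
move: h; apply: eq_gext => [a u v|a u v|x].
- by rewrite gcomulL (tlift_linear B).
- by rewrite gcounitL scalerDl scalerA.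
rewrite gcomul_gelt (tlift_tens B) /= gcounit_gelt gantipode_gelt geltM mulgV.
by rewrite gelt1 scale1r.
Qed.

HB.instance Definition _ := isHopf.Build k kG
  gcomulA gcomul1l gcomul1r gantipodel gantipoder.

End GroupHopf.

Section Extensions.
Variable k : fieldType.

Definition alg_hom (A B : algType k) (f : A -> B) :=
  linear f /\ monoid_morphism f.

Definition alg_iso (A B : algType k) (f : A -> B) := alg_hom f /\ bijective f.

(* Compatibility with the antipodes is automatic. *)
Definition hopf_iso (H H' : hopfAlgType k) (f : H -> H') :=
  [/\ alg_iso f, forall h, comul (f h) = tmap f f (comul h)
    & forall h, counit (f h) = counit h].

(* The data of a map A -> B of algebras and of a coaction B -> B ⊗ H; the
   axioms are in [cleft]. *)
Record extension (A H : algType k) := Extension {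
  ext_alg :> algType k;
  incl : A -> ext_alg;
  coact : ext_alg -> ext_alg ⊗ H
}.

Definition comodule_algebra (H : hopfAlgType k) (B : algType k)
    (rho : B -> B ⊗ H) :=
  [/\ alg_hom rho,
      forall b, tassoc (tmap rho idfun (rho b)) = tmap idfun comul (rho b)
    & forall b, tlift (fun b0 b1 => (counit b1 : k) *: b0) (rho b) = b].

Definition comodule_map (H : hopfAlgType k) (B : algType k)
    (rho : B -> B ⊗ H) (gamma : H -> B) :=
  linear gamma /\ forall h, rho (gamma h) = tmap gamma idfun (comul h).

Definition conv_invertible (H : hopfAlgType k) (B : algType k) (gamma : H -> B) :=
  exists gamma' : H -> B, [/\ linear gamma',
    forall h, tlift (fun x y => gamma x * gamma' y) (comul h) = (counit h : k) *: 1
  & forall h, tlift (fun x y => gamma' x * gamma y) (comul h) = (counit h : k) *: 1].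

Definition cleft (A : algType k) (H : hopfAlgType k) (E : extension A H) :=
  [/\ comodule_algebra (@coact _ _ E),
      alg_hom (@incl _ _ E) /\ injective (@incl _ _ E),
      forall b : E, coact b = b ⊗ 1 <-> exists a, incl E a = b
    & exists gamma : H -> E, comodule_map (@coact _ _ E) gamma /\
                             conv_invertible gamma].

Definition twist_equivalent (A : algType k) (H : hopfAlgType k)
    (E E' : extension A H) :=
  exists (phiA : A -> A) (phiH : H -> H) (f : E -> E'),
    [/\ alg_iso phiA, hopf_iso phiH, alg_iso f,
        forall (a : A) (b : E), f (incl E a * b) = incl E' (phiA a) * f b
      & forall b : E, tmap f idfun (coact b) = tmap idfun phiH (coact (f b))].

(* id ⊗ Δ *)
Definition coactR (V : lmodType k) (H : hopfAlgType k) (x : V ⊗ H) : (V ⊗ H) ⊗ H :=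
   tassoc' (tmap idfun comul x).

Lemma coactR_tens (V : lmodType k) (H : hopfAlgType k) (v : V) (h : H) :
  coactR (v ⊗ h) = tlift (fun x y => (v ⊗ x) ⊗ y) (comul h).
Proof.
have idL : linear (@idfun V) by [].
have B u : bilin (fun x y : H => (u : V) ⊗ x ⊗ y).
  split=> [y|x] a s t; last by rewrite tensDr tensZr.
  by rewrite tensDr tensZr tensDl tensZl.
have B' : bilin (fun (u : V) (z : H ⊗ H) => tlift (fun x y => u ⊗ x ⊗ y) z).
  split=> [z|u]; last exact: tlift_linear.
  by apply: tlift_param_linear => x y a s t; rewrite !(tensDl, tensZl).
rewrite /coactR /tmap (tlift_tens (tmap_bilin idL _)); last exact: linearP.
exact: (tlift_tens B').
Qed.

Definition trivial_ext (A : algType k) (H : hopfAlgType k) : extension A H :=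
  @Extension A H (A ⊗ H)%type (fun a => a ⊗ 1) (@coactR A H).

Definition heisenberg_ext (L : fdHopfAlgType k) : extension (dual L) L :=
  @Extension (dual L) L (heisenberg L) (fun a => a ⊗ 1) (@coactR (dual L) L).

(* The H ⊗ H'-extension E ⊗ H' of A, with coaction
   b ⊗ h |-> \sum (b_0 ⊗ h_1) ⊗ (b_1 ⊗ h_2). *)
Definition tensor_ext (A H : algType k) (E : extension A H) (H' : hopfAlgType k) :
    extension A (H ⊗ H')%type :=
  @Extension A (H ⊗ H')%type (E ⊗ H')%type (fun a => incl E a ⊗ 1)
    (tlift (fun (b : E) (h : H') =>
       tlift (fun b0 b1 =>
         tlift (fun h1 h2 => (b0 ⊗ h1) ⊗ (b1 ⊗ h2)) (comul h)) (coact b))).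

Lemma tensor_ext_coact (A H : algType k) (E : extension A H) (H' : hopfAlgType k)
    (b : E) (h : H') : linear (@coact _ _ E) ->
  @coact _ _ (tensor_ext E H') (b ⊗ h) =
  tlift (fun b0 b1 => tlift (fun h1 h2 => (b0 ⊗ h1) ⊗ (b1 ⊗ h2)) (comul h)) (coact b).
Proof.
move=> coL; apply: tlift_tens.
have B (b0 : E) (b1 : H) : bilin (fun h1 h2 : H' => (b0 ⊗ h1) ⊗ (b1 ⊗ h2)).
  by split=> [y|x] a s t; rewrite !(tensDr, tensZr) ?tensDl ?tensZl.
split=> [h'|b'].
  apply: tlift_linear_comp => //; split=> [b1|b0]; apply: tlift_param_linear.
    by move=> x y a s t; rewrite !(tensDl, tensZl).
  by move=> x y a s t; rewrite tensDl tensZl tensDr tensZr.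
apply: tlift_param_linear => b0 b1 a s t.
by rewrite linearP (tlift_linear (B _ _)).
Qed.

(* Transport of an extension along maps A' -> A and H -> H'. *)
Definition transport_ext (A A' H H' : algType k) (psi : A' -> A) (theta : H -> H')
    (E : extension A H) : extension A' H' :=
  @Extension A' H' E (fun a => incl E (psi a)) (fun b => tmap idfun theta (coact b)).

(* The natural map k[C] ⊗ k[D] -> k[G], c ⊗ d |-> c d, for C, D subgroups of G. *)
Definition groupAlg_prod (gT : finGroupType) (C D : {group gT}) :
    groupAlg k (subg_of C) ⊗ groupAlg k (subg_of D) -> groupAlg k gT :=
  tlift (fun x y => gext (fun c => gelt k (sgval c)) x * gext (fun d => gelt k (sgval d)) y).

Lemma groupAlg_prod_gelt (gT : finGroupType) (C D : {group gT})
    (c : subg_of C) (d : subg_of D) :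
  groupAlg_prod (gelt k c ⊗ gelt k d) = gelt k (sgval c * sgval d)%g.
Proof.
rewrite /groupAlg_prod tlift_tens ?gext_gelt ?geltM //.
split=> [y|x] a s t; rewrite gext_linear.
  by rewrite mulrDl -scalerAl.
by rewrite mulrDr -scalerAr.
Qed.

Lemma heisenberg_extM (L : fdHopfAlgType k) (a b : dual L) (h l : L) :
  (a ⊗ h : heisenberg_ext L) * (b ⊗ l : heisenberg_ext L) =
  tlift (fun h1 h2 => (a * hit h1 b) ⊗ (h2 * l)) (comul h).
Proof. exact: smashM. Qed.

End Extensions.

(* {poly %/ h} is the quotient by (h) only if h is monic of positive degree, which
   holds here for p > 1. *)
Notation ASalg k p := {poly %/ ('X^p - 'X : {poly k})}.

(* Main.v *)
From HB Require Import structures.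
Require Import Defs.
From mathcomp Require Import all_boot all_order all_algebra all_fingroup.
From mathcomp Require Import all_solvable.
From mathcomp Require Import qpoly.
From mathcomp Require Import boolp.

(* A k[G]-cleft extension E of A is a G-graded algebra with a unit u_g in every
   degree and with degree-one part A.  Conjugation by u_g lets G act on A, that
   is, on the p characters of A.  When g acts trivially, u_g^p is a unit of A,
   and rescaling u_g by a p-th root of it gives the unique element v_g of degree
   g with v_g^p = 1; uniqueness makes the v_g multiplicative and central.  So a
   trivial action gives A ⊗ k[G].  Otherwise some c moves a character; since c
   has order p, its powers permute the p characters simply transitively, so G is
   the product of C = <c> and the kernel G' of the action.  Then u_c^p lies in
   the fixed algebra k, hence u_c rescales to v_c with v_c^p = 1, and the
   elements v_c^i v_d (d in G') present E as the skew group algebra of G over A.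
   The functions x |-> chi (x . a) on C identify A with k[C]^*, equivariantly. *)

Set Implicit Arguments.
Unset Strict Implicit.
Unset Printing Implicit Defensive.

Import GRing.Theory.
Local Open Scope ring_scope.

(** * Linear maps and tensors *)

Section Linear.
Variable k : fieldType.
Implicit Types U V W : lmodType k.

Lemma linear_bundle U V (f : U -> V) :
  linear f -> exists F : {linear U -> V}, (F : U -> V) = f.
Proof.
move=> fL; pose m := GRing.isLinear.Build k U V _ f fL.
by pose F : {linear U -> V} := HB.pack f m; exists F.
Qed.

Lemma tmap_linear V W V' W' (f : V -> V') (g : W -> W') :
  linear f -> linear g -> linear (tmap f g).
Proof. by move=> fL gL; apply: tlift_linear; apply: tmap_bilin. Qed.

Lemma tmap_tens V W V' W' (f : V -> V') (g : W -> W') v w :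
  linear f -> linear g -> tmap f g (v ⊗ w) = f v ⊗ g w.
Proof. by move=> fL gL; rewrite /tmap (tlift_tens (tmap_bilin fL gL)). Qed.

Lemma tmap_id V W (x : V ⊗ W) : tmap idfun idfun x = x.
Proof.
move: x; apply: eq_tens => // [|v w]; first exact: tmap_linear.
by rewrite tmap_tens.
Qed.

End Linear.

Section AlgIso.
Variable k : fieldType.
Implicit Types A B C : algType k.

Lemma alg_iso_inv A B (f : A -> B) (g : B -> A) :
  alg_hom f -> cancel f g -> cancel g f -> alg_iso g.
Proof.
move=> [fL [f1 fM]] fK gK; split; last by exists f.
split=> [t x y|]; first by rewrite -{1}(gK x) -{1}(gK y) -fL fK.
by split=> [|x y]; rewrite -?f1 ?fK // -{1}(gK x) -{1}(gK y) -fM fK.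
Qed.

Lemma alg_iso_comp A B C (f : A -> B) (g : B -> C) :
  alg_iso f -> alg_iso g -> alg_iso (g \o f).
Proof.
move=> [[fL [f1 fM]] fbij] [[gL [g1 gM]] gbij]; split; last exact: bij_comp.
split=> [t x y|] /=; first by rewrite fL gL.
by split=> [|x y] /=; rewrite ?f1 ?fM.
Qed.

End AlgIso.

Section Coefficient.
Variables (k : fieldType) (gT : finGroupType) (V : lmodType k).
Local Notation kG := (groupAlg k gT).

(** The group elements form a basis of [kG], so these maps are the coordinates of V ⊗ kG. Applied to
    a coaction they give the homogeneous components of an element. *)
Definition tcoef (g : gT) : V ⊗ kG -> V := tlift (fun (v : V) (h : kG) => (h g : k) *: v).

Lemma tcoef_bilin g : bilin (fun (v : V) (h : kG) => (h g : k) *: v).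
Proof.
split=> [h|v] a x y; first by rewrite scalerDr !scalerA mulrC.
by rewrite !ffunE scalerDl scalerA.
Qed.

Lemma tcoef_linear g : linear (tcoef g).
Proof. exact/tlift_linear/tcoef_bilin. Qed.

Lemma tcoef_tens g v h : tcoef g (v ⊗ h) = (h g : k) *: v.
Proof. exact/tlift_tens/tcoef_bilin. Qed.

Lemma tcoef_gelt g v h : tcoef g (v ⊗ gelt k h) = (if g == h then v else 0).
Proof. by rewrite tcoef_tens ffunE; case: eqP => _; rewrite ?scale1r ?scale0r. Qed.

Lemma tens_sumr (v : V) I (r : seq I) (F : I -> kG) :
  v ⊗ (\sum_(i <- r) F i) = \sum_(i <- r) (v ⊗ F i).
Proof.
have [T TE] := linear_bundle ((bilin_tens V kG).2 v).
by rewrite -TE linear_sum.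
Qed.

Lemma tcoefE (x : V ⊗ kG) : x = \sum_g tcoef g x ⊗ gelt k g.
Proof.
have L : linear (fun x => \sum_g tcoef g x ⊗ gelt k g).
  move=> a u v; rewrite scaler_sumr -big_split; apply: eq_bigr => g _ /=.
  by rewrite tcoef_linear tensDl tensZl.
move: x; apply: (eq_tens (f := idfun) _ L) => // v h /=.
rewrite {1}(groupAlgE h) /gext tens_sumr; apply: eq_bigr => g _.
by rewrite tcoef_tens tensZr tensZl.
Qed.

End Coefficient.

(** * Skew group algebras *)

Section Frames.
Variables (k : fieldType) (gT : finGroupType) (A : algType k).
Local Notation kG := (groupAlg k gT).
Implicit Types E : extension A kG.

(* A frame exhibits E as the skew group algebra of gT over A for the action sg. *)
Record frame E (v : gT -> E) (sg : gT -> A -> A) : Prop := Frame {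
  frame_incl : alg_hom (@incl _ _ _ E);
  frame_inj : injective (@incl _ _ _ E);
  frame_coact : linear (@coact _ _ _ E);
  frame1 : v 1%g = 1;
  frameM : {morph v : g h / (g * h)%g >-> g * h};
  frame_hom a g : coact (incl E a * v g) = (incl E a * v g) ⊗ gelt k g;
  frame_act g a : v g * incl E a = incl E (sg g a) * v g;
  frame_span b : exists a : gT -> A, b = \sum_g incl E (a g) * v g
}.

Section One.
Variables (E : extension A kG) (v : gT -> E) (sg : gT -> A -> A).
Hypothesis Fr : frame v sg.

(** The products [incl E a * v x] span E, so identities between linear maps need to be checked only
    on them. *)
Lemma frame_ext (U : lmodType k) (f g : E -> U) : linear f -> linear g ->
  (forall a x, f (incl E a * v x) = g (incl E a * v x)) -> f =1 g.
Proof.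
move=> /linear_bundle[f' <-] /linear_bundle[g' <-] fg b.
have [a ->] := frame_span Fr b.
by rewrite !linear_sum; apply: eq_bigr.
Qed.

Lemma frameVr g : v g * v g^-1%g = 1.
Proof. by rewrite -(frameM Fr) mulgV (frame1 Fr). Qed.

Lemma frame_coef (a : gT -> A) g :
  tcoef g (coact (\sum_h incl E (a h) * v h)) = incl E (a g) * v g.
Proof.
have [C CE] := linear_bundle (frame_coact Fr).
have [T TE] := linear_bundle (@tcoef_linear k gT E g).
rewrite -CE linear_sum CE -TE linear_sum TE (bigD1 g) //= big1 => [|h hg].
  by rewrite (frame_hom Fr) tcoef_gelt eqxx addr0.
by rewrite (frame_hom Fr) tcoef_gelt eq_sym (negPf hg).
Qed.

(** The coaction separates the summands by degree, and [v g] can be cancelled because [v g^-1] is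
    its inverse. With [frame_span], this makes E a free left A-module on the [v g]. *)
Lemma frame_uniq (a b : gT -> A) :
  \sum_g incl E (a g) * v g = \sum_g incl E (b g) * v g -> a =1 b.
Proof.
move=> ab g; apply: (frame_inj Fr).
have := congr1 (fun x => tcoef g (coact x) * v g^-1%g) ab.
by rewrite !frame_coef -!mulrA frameVr !mulr1.
Qed.

(** Freeness over A lets a linear map be prescribed on each summand A [v g]. *)
Lemma frame_map E' (v' : gT -> E') (phi : A -> E') : linear phi ->
  exists2 f : E -> E', linear f
    & forall a g, f (incl E a * v g) = phi a * v' g.
Proof.
move=> phiL; have [cr crE] := choice (frame_span Fr).
have [I IE] := linear_bundle (frame_incl Fr).1.
have crP (a : gT -> A) : cr (\sum_g incl E (a g) * v g) =1 a.
  by apply: frame_uniq; rewrite -crE.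
have [P PE] := linear_bundle phiL.
exists (fun b => \sum_g phi (cr b g) * v' g) => [t x y|a g].
  (* The coefficients [cr] come from a mere choice; their uniqueness makes them linear. *)
  have crL : cr (t *: x + y) =1 (fun g => t *: cr x g + cr y g).
    apply: frame_uniq; rewrite -crE {1}(crE x) {1}(crE y) scaler_sumr -big_split.
    by apply: eq_bigr => g _; rewrite (frame_incl Fr).1 mulrDl scalerAl.
  rewrite scaler_sumr -big_split; apply: eq_bigr => g _.
  by rewrite crL phiL mulrDl scalerAl.
have -> : incl E a * v g = \sum_h incl E (if h == g then a else 0) * v h.
  rewrite (bigD1 g) //= eqxx big1 ?addr0 // => h /negPf ->.
  by rewrite -IE linear0 mul0r.
rewrite (bigD1 g) //= crP eqxx big1 ?addr0 // => h /negPf hg.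
by rewrite crP hg -PE linear0 mul0r.
Qed.

(** Move [incl E a] past [v (g * h)] in one step or past [v h] and then [v g], and cancel
    [v (g * h)]. *)
Lemma frame_sgM g h a : sg g (sg h a) = sg (g * h)%g a.
Proof.
apply: (frame_inj Fr); have := congr1 ( *%R^~ (v (g * h)^-1%g)) (frame_act Fr (g * h)%g a).
rewrite -[in RHS]mulrA frameVr mulr1 => <-.
rewrite (frameM Fr) -[v g * _ * _]mulrA (frame_act Fr h) mulrA (frame_act Fr g).
by rewrite -!mulrA [v g * _]mulrA -(frameM Fr) frameVr mulr1.
Qed.

End One.

Section Two.
Variables (E E' : extension A kG) (v : gT -> E) (v' : gT -> E').
Variables (sg sg' : gT -> A -> A) (phi : A -> A).
Hypotheses (Fr : frame v sg) (Fr' : frame v' sg').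
Hypotheses (phi_hom : alg_hom phi)
  (phi_sg : forall g a, phi (sg g a) = sg' g (phi a)).

(** On generators the product is (a v_g)(c v_h) = a sg_g(c) v_{gh}, so multiplicativity amounts to
    phi intertwining the two actions. *)
Lemma frame_alg_map : exists2 f : E -> E', alg_hom f
  & forall a g, f (incl E a * v g) = incl E' (phi a) * v' g.
Proof.
have [phiL [phi1 phiM]] := phi_hom.
have [iL [i1 iM]] := frame_incl Fr.
have [iL' [i1' iM']] := frame_incl Fr'.
have phiL' : linear (fun a => incl E' (phi a)) by move=> t x y; rewrite phiL iL'.
have [f fL fE] := frame_map Fr v' phiL'.
exists f => //; split=> //; split.
  by rewrite -[1](mulr1 1) -{1}i1 -(frame1 Fr) fE phi1 i1' mul1r (frame1 Fr').
move=> x y; move: x; apply: (frame_ext Fr) => [t a b|t a b|a g].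
- by rewrite mulrDl -scalerAl fL.
- by rewrite fL mulrDl -scalerAl.
move: y; apply: (frame_ext Fr) => [t c d|t c d|c h].
- by rewrite mulrDr -scalerAr fL.
- by rewrite fL mulrDr -scalerAr.
rewrite mulrA -[_ * v g * _]mulrA (frame_act Fr) mulrA -iM -mulrA -(frameM Fr) !fE.
rewrite phiM phi_sg iM' (frameM Fr') -mulrA -[RHS]mulrA; congr (_ * _).
by rewrite [RHS]mulrA (frame_act Fr') -mulrA.
Qed.

End Two.

(** Isomorphic actions give twist equivalent extensions: phi and its inverse induce mutually inverse
    algebra maps. They send [v g] to [v' g] and back, preserving degrees, so the Hopf automorphism
    can be the identity. *)
Theorem frame_twist (E E' : extension A kG) (v : gT -> E) (v' : gT -> E')
    (sg sg' : gT -> A -> A) (phi : A -> A) :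
  frame v sg -> frame v' sg' -> alg_iso phi ->
  (forall g a, phi (sg g a) = sg' g (phi a)) -> twist_equivalent E E'.
Proof.
move=> Fr Fr' phi_iso phi_sg; have [phi_hom [phi' phiK phi'K]] := phi_iso.
have [phiL [phi1 phiM]] := phi_hom.
have [phi'_hom _] := alg_iso_inv phi_hom phiK phi'K.
have phi'_sg g a : phi' (sg' g a) = sg g (phi' a).
  by apply: (can_inj phiK); rewrite phi_sg !phi'K.
have [f f_hom fE] := frame_alg_map Fr Fr' phi_hom phi_sg.
have [f' f'_hom f'E] := frame_alg_map Fr' Fr phi'_hom phi'_sg.
have [fL [f1 fM]] := f_hom; have [f'L _] := f'_hom.
exists phi, idfun, f; split=> //.
- by split=> [|h|//]; [split=> //; exists idfun|rewrite tmap_id].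
- split=> //; exists f'.
    apply: (frame_ext Fr (f := f' \o f)) => [t x y|//|a g] /=; first by rewrite fL f'L.
    by rewrite fE f'E phiK.
  apply: (frame_ext Fr' (f := f \o f')) => [t x y|//|a g] /=; first by rewrite f'L fL.
  by rewrite f'E fE phi'K.
- by move=> a b; rewrite fM -[incl E a]mulr1 -(frame1 Fr) fE (frame1 Fr') mulr1.
move=> b; rewrite tmap_id.
move: b; apply: (frame_ext Fr) => [t x y|t x y|a g].
- by rewrite (frame_coact Fr) tmap_linear.
- by rewrite fL (frame_coact Fr').
by rewrite (frame_hom Fr) tmap_tens // fE (frame_hom Fr').
Qed.

End Frames.

(** * The trivial and Heisenberg extensions *)

Section Coaction.
Variable k : fieldType.

Lemma coactR_linear (V : lmodType k) (H : hopfAlgType k) : linear (@coactR k V H).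
Proof.
have B v : bilin (fun x y : H => (v : V) ⊗ x ⊗ y).
  by split=> [y|x] a s t; rewrite !(tensDr, tensZr) // tensDl tensZl.
have B' : bilin (fun (v : V) (z : H ⊗ H) => tlift (fun x y => v ⊗ x ⊗ y) z).
  split=> [z|v]; last exact: tlift_linear.
  by apply: tlift_param_linear => x y a s t; rewrite !(tensDl, tensZl).
move=> a x y; rewrite /coactR tmap_linear //; last exact: linearP.
exact: (tlift_linear B').
Qed.

Lemma coactR_gelt (gT : finGroupType) (V : lmodType k) (v : V) (g : gT) :
  coactR (v ⊗ gelt k g) = (v ⊗ gelt k g) ⊗ gelt k g.
Proof.
rewrite coactR_tens [comul _]gcomul_gelt tlift_tens //.
by split=> [y|x] a s t; rewrite !(tensDr, tensZr) // tensDl tensZl.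
Qed.

Lemma tensor_ext_coact_linear (A H : algType k) (H' : hopfAlgType k) (E : extension A H) :
  linear (@coact _ _ _ E) -> linear (@coact _ _ _ (tensor_ext E H')).
Proof.
move=> coL; apply: tlift_linear.
have B (b0 : E) (b1 : H) : bilin (fun h1 h2 : H' => (b0 ⊗ h1) ⊗ (b1 ⊗ h2)).
  by split=> [y|x] a s t; rewrite !(tensDr, tensZr) ?tensDl ?tensZl.
split=> [h'|b'].
  apply: tlift_linear_comp => //; split=> [b1|b0]; apply: tlift_param_linear.
    by move=> x y a s t; rewrite !(tensDl, tensZl).
  by move=> x y a s t; rewrite tensDl tensZl tensDr tensZr.
apply: tlift_param_linear => b0 b1 a s t.
by rewrite linearP (tlift_linear (B _ _)).
Qed.

Lemma transport_coact_linear (A A' H H' : algType k) (psi : A' -> A)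
    (theta : H -> H') (E : extension A H) :
  linear theta -> linear (@coact _ _ _ E) ->
  linear (@coact _ _ _ (transport_ext psi theta E)).
Proof. by move=> thL coL a x y; rewrite /= coL tmap_linear. Qed.

Lemma tens_one (A B : algType k) : (1 : A) ⊗ (1 : B) = 1.
Proof. by []. Qed.

Lemma tens_suml (V W : lmodType k) I (r : seq I) (F : I -> V) (w : W) :
  (\sum_(i <- r) F i) ⊗ w = \sum_(i <- r) (F i ⊗ w).
Proof.
have [T TE] := linear_bundle ((bilin_tens V W).1 w).
rewrite -[LHS]/((fun v => v ⊗ w) _) -TE linear_sum.
by apply: eq_bigr => i _; rewrite TE.
Qed.

Lemma tens1_alg_hom (A B : algType k) : alg_hom (fun a : A => a ⊗ (1 : B)).
Proof.
split=> [t x y|]; first by rewrite tensDl tensZl.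
by split=> // x y; rewrite tensM mulr1.
Qed.

Lemma tens_gelt_inj (gT : finGroupType) (V : lmodType k) (g : gT) :
  injective (fun v : V => v ⊗ gelt k g).
Proof. by move=> v w /(congr1 (tcoef g)); rewrite !tcoef_gelt eqxx. Qed.

End Coaction.

Section TrivialFrame.
Variables (k : fieldType) (gT : finGroupType) (A : algType k).

Lemma trivial_frame :
  frame (E := trivial_ext A (groupAlg k gT)) (fun g => 1 ⊗ gelt k g) (fun _ a => a).
Proof.
have E (a : A) (g : gT) : (a ⊗ (1 : groupAlg k gT)) * (1 ⊗ gelt k g) = a ⊗ gelt k g.
  by rewrite tensM mulr1 mul1r.
split=> //=.
- exact: tens1_alg_hom.
- exact: tens_gelt_inj.
- exact: coactR_linear.
- by move=> g h; rewrite tensM mul1r geltM.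
- by move=> a g; rewrite !E coactR_gelt.
- by move=> g a; rewrite !tensM mulr1 mul1r mul1r mulr1.
move=> b; exists (fun g => tcoef g b); rewrite {1}(tcoefE b).
by apply: eq_bigr => g _; rewrite E.
Qed.

End TrivialFrame.

Section HeisenbergFrame.
Variables (k : fieldType) (gT : finGroupType).
Local Notation kG := (groupAlg k gT).
Local Notation D := (dual kG).
Local Notation Hs := (heisenberg kG).

(** Group elements are grouplike, so the sum defining the smash product has a single term. *)
Lemma heis_gelt_tens (a b : D) (g : gT) (h : kG) :
  (a ⊗ gelt k g : Hs) * (b ⊗ h) = (a * hit (gelt k g) b) ⊗ (gelt k g * h).
Proof.
rewrite smashM [comul _]gcomul_gelt tlift_tens //.
exact: smash2_in_bilin.
Qed.

Lemma heis_incl_gelt (a : D) (g : gT) :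
  (a ⊗ 1 : Hs) * (1 ⊗ gelt k g) = a ⊗ gelt k g.
Proof. by rewrite -gelt1 heis_gelt_tens gelt1 hit1 mulr1 mul1r. Qed.

Lemma heis_incl_alg_hom : alg_hom (fun a : D => a ⊗ (1 : kG) : Hs).
Proof.
split=> [t x y|]; first by rewrite tensDl tensZl.
by split=> // x y; rewrite -gelt1 heis_gelt_tens gelt1 hit1 mulr1.
Qed.

Lemma hit_gelt_one (g : gT) : hit (gelt k g) (1 : D) = 1.
Proof. by rewrite hit_one [counit _]gcounit_gelt scale1r. Qed.

Lemma heis_geltM (g h : gT) :
  (1 ⊗ gelt k g : Hs) * (1 ⊗ gelt k h) = 1 ⊗ gelt k (g * h)%g.
Proof. by rewrite heis_gelt_tens hit_gelt_one mulr1 geltM. Qed.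

Lemma heis_gelt_incl (a : D) (g : gT) :
  (1 ⊗ gelt k g : Hs) * (a ⊗ 1) = (hit (gelt k g) a ⊗ 1 : Hs) * (1 ⊗ gelt k g).
Proof. by rewrite heis_gelt_tens heis_incl_gelt mul1r mulr1. Qed.

(** The Heisenberg double of a group algebra is the skew group algebra for right translation of
    functions on the group. *)
Lemma heisenberg_frame :
  frame (E := heisenberg_ext kG) (fun g => 1 ⊗ gelt k g) (fun g => hit (gelt k g)).
Proof.
split=> //=.
- exact: heis_incl_alg_hom.
- exact: tens_gelt_inj.
- exact: coactR_linear.
- by move=> g h; rewrite heis_geltM.
- by move=> a g; rewrite heis_incl_gelt coactR_gelt.
- by move=> g a; rewrite heis_gelt_incl.
move=> b; exists (fun g => tcoef g b); rewrite {1}(tcoefE b).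
by apply: eq_bigr => g _; rewrite heis_incl_gelt.
Qed.

End HeisenbergFrame.

(** * Tensoring with a group algebra along a direct product of groups *)

Section TransportFrame.
Variables (k : fieldType) (gT : finGroupType) (C D : {group gT}).
Local Notation kC := (groupAlg k (subg_of C)).
Local Notation kD := (groupAlg k (subg_of D)).
Hypothesis CD : (C \x D)%g = [set: gT].
Variables (A B : algType k) (psi : A -> B) (psi' : B -> A).
Hypotheses (psi_hom : alg_hom psi) (psiK : cancel psi psi') (psi'K : cancel psi' psi).

(** The two projections of the internal direct product, valued in the subgroup types over which [kC]
    and [kD] are built. *)
Lemma dprod_split : exists (c : gT -> subg_of C) (d : gT -> subg_of D),
  [/\ forall g, (sgval (c g) * sgval (d g))%g = g,
      forall (x : subg_of C) (y : subg_of D), c (sgval x * sgval y)%g = x,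
      forall (x : subg_of C) (y : subg_of D), d (sgval x * sgval y)%g = y
    & {morph c : g h / (g * h)%g} /\ {morph d : g h / (g * h)%g}].
Proof.
have /choice[cd cdE] g : exists xy : subg_of C * subg_of D,
    (sgval xy.1 * sgval xy.2)%g = g /\
    forall (x : subg_of C) (y : subg_of D), (sgval x * sgval y)%g = g -> x = xy.1 /\ y = xy.2.
  have [x [y [Cx Dy -> xyP]]] := mem_dprod CD (in_setT g).
  exists (subg C x, subg D y); rewrite /= !subgK //; split=> // u w uw.
  have [<- <-] := xyP _ _ (subgP u) (subgP w) (esym uw).
  by rewrite !sgvalK.
have cdK x y := (cdE (sgval x * sgval y)%g).2 x y erefl.
(* C and D commute elementwise, so multiplying the components of g and h gives a decomposition of
   gh; uniqueness then makes the projections homomorphisms. *)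
have cdM g h : (sgval ((cd g).1 * (cd h).1) * sgval ((cd g).2 * (cd h).2))%g = (g * h)%g.
  have [_ _ /centsP cCD _] := dprodP CD.
  rewrite !morphM ?inE // -{3}(cdE g).1 -{3}(cdE h).1 -!mulgA; congr (_ * _)%g.
  by rewrite !mulgA (cCD _ (subgP _) _ (subgP _)).
exists (fun g => (cd g).1), (fun g => (cd g).2); split=> [g|x y|x y|].
- exact: (cdE g).1.
- by have [<-] := cdK x y.
- by have [_ <-] := cdK x y.
by split=> g h; have [] := (cdE (g * h)%g).2 _ _ (cdM g h).
Qed.

Lemma groupAlg_prod_linear : linear (@groupAlg_prod k gT C D).
Proof.
apply: tlift_linear; split=> [y|x] a s t; rewrite gext_linear.
  by rewrite mulrDl -scalerAl.
by rewrite mulrDr -scalerAr.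
Qed.

Lemma groupAlg_tens_bilin (E : lmodType k) (b : E) (h : kC) :
  bilin (fun h1 h2 : kD => (b ⊗ h1) ⊗ (h ⊗ h2)).
Proof. by split=> [y|x] a s t; rewrite !(tensDr, tensZr) ?tensDl ?tensZl. Qed.

Lemma tensor_coact_gelt (E : extension B kC) (b : E) (x : subg_of C) (y : subg_of D) :
  linear (@coact _ _ _ E) -> coact b = b ⊗ gelt k x ->
  @coact _ _ _ (tensor_ext E kD) (b ⊗ gelt k y) =
    (b ⊗ gelt k y) ⊗ (gelt k x ⊗ gelt k y).
Proof.
move=> coL bx; rewrite (tensor_ext_coact _ _ coL) bx tlift_tens.
  rewrite [comul _]gcomul_gelt tlift_tens //; exact: groupAlg_tens_bilin.
split=> [h|b']; apply: tlift_param_linear => u w r s t.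
  by rewrite !(tensDl, tensZl).
by rewrite tensDl tensZl tensDr tensZr.
Qed.

(** The unit in degree g is [v (c g) ⊗ gelt k (d g)]. The second factor commutes with the image of
    A, so only the C-component of g acts, through the identification psi. *)
Lemma transport_frame (E : extension B kC) v sg : frame (E := E) v sg ->
  exists c : gT -> subg_of C, exists d : gT -> subg_of D,
  (forall g, (sgval (c g) * sgval (d g))%g = g) /\
  frame (E := transport_ext psi (groupAlg_prod (C := C) (D := D)) (tensor_ext E kD))
    (fun g => v (c g) ⊗ gelt k (d g))
    (fun g a => psi' (sg (c g) (psi a))).
Proof.
move=> Fr; have [c [d [cdE cE dE [cM dM]]]] := dprod_split.
exists c, d; split=> //.
have [psiL [psi1 psiM]] := psi_hom.
have [iL [i1 iM]] := frame_incl Fr.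
have E1 a g : (incl E a ⊗ (1 : kD)) * (v (c g) ⊗ gelt k (d g)) =
    (incl E a * v (c g)) ⊗ gelt k (d g).
  by rewrite tensM mul1r.
have coL := frame_coact Fr.
have TL := tensor_ext_coact_linear (H' := kD) coL.
split.
- split=> [t x y|] /=; first by rewrite psiL iL tensDl tensZl.
  split; first by rewrite psi1 i1.
  by move=> x y; rewrite psiM iM tensM mulr1.
- by move=> x y /(@tens_gelt_inj k _ E) /(frame_inj Fr)/(can_inj psiK).
- exact: (transport_coact_linear (psi := psi) groupAlg_prod_linear TL).
- have -> : c 1%g = 1%g by have := cE 1%g 1%g; rewrite mulg1.
  have -> : d 1%g = 1%g by have := dE 1%g 1%g; rewrite mulg1.
  by rewrite gelt1 (frame1 Fr) tens_one.
- by move=> g h; rewrite cM dM tensM (frameM Fr) geltM.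
- move=> a g; rewrite [incl _ a * _]E1.
  have -> : gelt k g = groupAlg_prod (gelt k (c g) ⊗ gelt k (d g)).
    by rewrite groupAlg_prod_gelt cdE.
  transitivity (tmap idfun (@groupAlg_prod k gT C D)
    (@coact _ _ _ (tensor_ext E kD) ((incl E (psi a) * v (c g)) ⊗ gelt k (d g)))) => //.
  rewrite (tensor_coact_gelt _ coL (frame_hom Fr _ _)) tmap_tens //.
  exact: groupAlg_prod_linear.
- by move=> g a; rewrite /= psi'K !tensM (frame_act Fr) mulr1 mul1r.
move=> b.
have /choice[a aE] y := frame_span Fr (tcoef y b).
exists (fun g => psi' (a (d g) (c g))).
(* Expand first in the basis of [kD], then each coefficient in the frame of E; the pairs (x, y) are
   then reindexed by the elements of the group. *)
transitivity (\sum_y \sum_x (incl E (a y x) * v x) ⊗ gelt k y).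
  by rewrite {1}(tcoefE b); apply: eq_bigr => y _; rewrite aE tens_suml.
rewrite exchange_big pair_big /=.
rewrite (reindex (fun g => (c g, d g))) /=.
  by apply: eq_bigr => g _; rewrite psi'K E1.
exists (fun xy => sgval xy.1 * sgval xy.2)%g => [g _|[x y] _] /=; first exact: cdE.
by rewrite cE dE.
Qed.

End TransportFrame.

(** * Split commutative algebras *)

Section Split.
Variable k : fieldType.

(* The characters chi identify A with the product of the copies of k indexed by T. *)
Record split_by (A : algType k) (T : finType) (chi : T -> A -> k^o) : Prop := SplitBy {
  split_hom t : alg_hom (chi t);
  split_inj a b : (forall t, chi t a = chi t b) -> a = b;
  split_surj (f : T -> k) : exists a, forall t, chi t a = f t
}.

Section Theory.
Variables (A : algType k) (T : finType) (chi : T -> A -> k^o).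
Hypothesis S : split_by chi.

Lemma split_byD t a b : chi t (a + b) = chi t a + chi t b.
Proof. by have [F <-] := linear_bundle (split_hom S t).1; rewrite linearD. Qed.

Lemma split_byZ t c a : chi t (c *: a) = c * chi t a.
Proof. by have [F <-] := linear_bundle (split_hom S t).1; rewrite linearZ. Qed.

Lemma split_by1 t : chi t 1 = 1. Proof. exact: (split_hom S t).2.1. Qed.

Lemma split_byM t a b : chi t (a * b) = chi t a * chi t b.
Proof. exact: (split_hom S t).2.2. Qed.

Lemma split_byX t a n : chi t (a ^+ n) = chi t a ^+ n.
Proof. by elim: n => [|n IHn]; rewrite ?split_by1 // !exprS split_byM IHn. Qed.

Lemma split_comm (a b : A) : a * b = b * a.
Proof. by apply: (split_inj S) => t; rewrite !split_byM mulrC. Qed.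

(** The indicator elements [e t] sum to 1, so some [x (e t)] is nonzero. Applying x to a e_t =
    chi_t(a) e_t and cancelling gives x = chi_t. *)
Lemma split_char (x : A -> k^o) : alg_hom x -> exists t, x =1 chi t.
Proof.
move=> [xL [x1 xM]].
have [e eE] := choice (fun t => split_surj S (fun s => (s == t)%:R)).
have e1 : \sum_t e t = 1.
  apply: (split_inj S) => s; have [F FE] := linear_bundle (split_hom S s).1.
  rewrite split_by1 -FE linear_sum FE (bigD1 s) //= big1 => [|t ts].
    by rewrite eE eqxx addr0.
  by rewrite eE eq_sym (negPf ts).
have [t xt] : exists t, x (e t) != 0.
  apply: contrapT => nt; have : x 1 != 0 by rewrite x1 oner_eq0.
  have [F FE] := linear_bundle xL.
  rewrite -e1 -FE linear_sum FE big1 ?eqxx // => t _.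
  by apply/eqP/negPn/negP => xt; apply: nt; exists t.
exists t => a; apply: (mulIf xt); rewrite -[LHS]xM.
have -> : a * e t = (chi t a : k) *: e t.
  apply: (split_inj S) => s; rewrite split_byM split_byZ eE.
  by have [->|] := eqVneq s t; rewrite ?mulr0.
by have [F <-] := linear_bundle xL; rewrite linearZ.
Qed.

End Theory.

Lemma split_reindex (A : algType k) (T T' : finType) (chi : T -> A -> k^o)
    (chi' : T' -> A -> k^o) (r : T' -> T) :
  split_by chi -> bijective r -> (forall x a, chi (r x) a = chi' x a) ->
  split_by chi'.
Proof.
move=> S [r' rK r'K] E; have E' t a : chi' (r' t) a = chi t a by rewrite -E r'K.
split=> [x|a b ab|f].
- have [L [c1 cM]] := split_hom S (r x).
  split=> [t a b|]; first by rewrite -!E L.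
  by split=> [|a b]; rewrite -!E.
- by apply: (split_inj S) => t; rewrite -!E'.
have [a aE] := split_surj S (f \o r').
by exists a => x; rewrite -E aE /= rK.
Qed.

Section Dual.
Variable gT : finGroupType.
Local Notation kG := (groupAlg k gT).

Lemma dual_ext (f g : dual kG) : (forall x, f (gelt k x) = g (gelt k x)) -> f = g.
Proof. by move=> fg; apply/dualP; apply: eq_gext => //; exact: dual_linear. Qed.

Lemma dualM_gelt (f g : dual kG) x : (f * g) (gelt k x) = f (gelt k x) * g (gelt k x).
Proof. by rewrite dualM [comul _]gcomul_gelt tlift_tens //; exact: dual_bilin. Qed.

Lemma dual1_gelt x : (1 : dual kG) (gelt k x) = 1.
Proof. by rewrite dual1 [counit _]gcounit_gelt. Qed.

Lemma mkdual_gext (f : gT -> k) x : mkdual (gext (f : gT -> k^o)) (gelt k x) = f x.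
Proof. by rewrite mkdualE ?gext_gelt //; exact: gext_linear. Qed.

(** Since group elements are grouplike, the product of the dual is pointwise: it is the algebra of
    functions on the group, and its characters are the evaluations. *)
Lemma dual_split : split_by (fun (x : gT) (f : dual kG) => f (gelt k x)).
Proof.
split=> [x|f g|f]; last by exists (mkdual (gext (f : gT -> k^o))) => x; exact: mkdual_gext.
- split=> [t f g|]; first by rewrite dualD dualZ.
  by split=> [|f g]; rewrite ?dual1_gelt ?dualM_gelt.
- exact: dual_ext.
Qed.

(** When the characters are indexed by a group, sending a to the function x |-> chi_x(a) identifies
    A with the functions on that group. *)
Lemma split_dual_iso (A : algType k) (chi : gT -> A -> k^o) : split_by chi ->
  exists2 theta : A -> dual kG, alg_iso theta
    & forall a x, theta a (gelt k x) = chi x a.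
Proof.
move=> S; pose theta a : dual kG := mkdual (gext (fun x => chi x a)).
have thE a x : theta a (gelt k x) = chi x a by exact: mkdual_gext.
exists theta => //; split; first split=> [t a b|].
- by apply: dual_ext => x; rewrite dualD dualZ !thE (split_byD S) (split_byZ S).
- split; first by apply: dual_ext => x; rewrite thE dual1_gelt (split_by1 S).
  by move=> a b; apply: dual_ext => x; rewrite dualM_gelt !thE (split_byM S).
have [theta' th'E] := choice (fun f : dual kG => split_surj S (fun x => f (gelt k x))).
exists theta' => [a|f]; first by apply: (split_inj S) => x; rewrite th'E thE.
by apply: dual_ext => x; rewrite thE th'E.
Qed.

End Dual.

End Split.

(** * Existence and uniqueness of p-th roots in characteristic p *)

Section ClosedField.
Variables (k : closedFieldType) (p : nat).
Hypothesis charkp : p \in [pchar k].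

Lemma closed_root (c : k) : exists x, x ^+ p = c.
Proof.
have p_gt0 := prime_gt0 (pcharf_prime charkp).
(* The monic equation is X^p = c: among the lower coefficients only the constant one is nonzero. *)
have [x xE] := solve_monicpoly (fun i => if i == 0%N then c else 0) p_gt0.
exists x; rewrite xE -(prednK p_gt0) big_ord_recl /= mulr1 big1 ?addr0 // => i _.
by rewrite mul0r.
Qed.

(** Frobenius is additive, so (x - 1)^p = x^p - 1 = 0. *)
Lemma pchar_root1 (x : k) : x ^+ p = 1 -> x = 1.
Proof.
move=> xp; apply/eqP; rewrite -subr_eq0.
suff : (x - 1) ^+ p == 0 by rewrite expf_eq0 => /andP[].
by rewrite -(pFrobenius_autE charkp) rmorphB /= !pFrobenius_autE xp expr1n subrr.
Qed.

Variables (A : algType k) (T : finType) (chi : T -> A -> k^o).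
Hypothesis S : split_by chi.

(** The characters of a unit are nonzero, so p-th roots of their inverses can be taken
    componentwise. *)
Lemma split_root (a b : A) : a * b = 1 -> exists c, c ^+ p * a = 1.
Proof.
move=> ab; have [f fE] := choice (fun t => closed_root (chi t a)^-1).
have [c cE] := split_surj S f; exists c; apply: (split_inj S) => t.
rewrite (split_byM S) (split_byX S) cE fE (split_by1 S) mulVf //.
apply/eqP => a0; have := split_by1 S t; rewrite -ab (split_byM S) a0 mul0r.
by move/esym/eqP; rewrite oner_eq0.
Qed.

Lemma split_root1 (a : A) : a ^+ p = 1 -> a = 1.
Proof.
move=> ap; apply: (split_inj S) => t; rewrite (split_by1 S).
by apply: pchar_root1; rewrite -(split_byX S) ap (split_by1 S).
Qed.

End ClosedField.

(** * Homogeneous units in cleft extensions *)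

Section Assoc.
Variable k : fieldType.
Implicit Types U V W : lmodType k.

Lemma tassoc_in_bilin U V W (w : W) : bilin (fun (u : U) (v : V) => u ⊗ (v ⊗ w)).
Proof. by split=> [v|u] a x y; rewrite !(tensDl, tensDr) !(tensZl, tensZr) ?tensDr ?tensZr. Qed.

Lemma tassoc_bilin U V W :
  bilin (fun (x : U ⊗ V) (w : W) => tlift (fun u v => u ⊗ (v ⊗ w)) x).
Proof.
split=> [w|x]; first exact/tlift_linear/tassoc_in_bilin.
apply: (tlift_param_linear (f := fun (w : W) (u : U) (v : V) => u ⊗ (v ⊗ w))) => u v b w w'.
by rewrite !(tensDr, tensZr).
Qed.

Lemma tassoc_linear U V W : linear (@tassoc k U V W).
Proof. exact/tlift_linear/tassoc_bilin. Qed.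

Lemma tassoc_tens U V W (u : U) (v : V) (w : W) : tassoc ((u ⊗ v) ⊗ w) = u ⊗ (v ⊗ w).
Proof.
by rewrite /tassoc (tlift_tens (tassoc_bilin _ _ _)) (tlift_tens (tassoc_in_bilin _ _ _)).
Qed.

End Assoc.

Section Cleft.
Variables (k : fieldType) (gT : finGroupType) (A : algType k).
Local Notation kG := (groupAlg k gT).
Variable E : extension A kG.
Hypothesis cE : cleft E.

Let rhoL : linear (@coact _ _ _ E). Proof. by case: cE => [[[]]]. Qed.
Let rhoM : monoid_morphism (@coact _ _ _ E). Proof. by case: cE => [[[]]]. Qed.
Let inclL : linear (@incl _ _ _ E). Proof. by case: cE => _ [[]]. Qed.
Let incl1 : incl E 1 = 1. Proof. by case: cE => _ [[_ []]]. Qed.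
Let inclM : {morph @incl _ _ _ E : a b / a * b}. Proof. by case: cE => _ [[_ []]]. Qed.
Let incl_inj : injective (@incl _ _ _ E). Proof. by case: cE => _ []. Qed.

(** A coaction of [kG] amounts to a grading by the group; this is membership in the component of
    degree g. *)
Definition homog g (b : E) := coact b = b ⊗ gelt k g.

Lemma homogM g h b c : homog g b -> homog h c -> homog (g * h)%g (b * c).
Proof. by rewrite /homog rhoM.2 => -> ->; rewrite tensM geltM. Qed.

Lemma homog1 : homog 1%g 1.
Proof. by rewrite /homog rhoM.1. Qed.

Lemma homogX g b n : homog g b -> homog (g ^+ n)%g (b ^+ n).
Proof.
move=> gb; elim: n => [|n IHn]; first exact: homog1.
by rewrite expgS exprS; exact: homogM.
Qed.

Lemma homog_incl a : homog 1%g (incl E a).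
Proof. by case: cE => _ _ coP _; apply/coP; exists a. Qed.

Lemma homog1P b : homog 1%g b -> exists a, incl E a = b.
Proof. by case: cE => _ _ coP _ /coP. Qed.

Lemma homogZ g c b : homog g b -> homog g (c *: b).
Proof.
rewrite /homog; have [F FE] := linear_bundle rhoL.
by rewrite -FE linearZ FE => ->; rewrite tensZl.
Qed.

Lemma homog_inclM a g b : homog g b -> homog g (incl E a * b).
Proof. by move=> gb; rewrite -[g]mul1g; apply: homogM => //; exact: homog_incl. Qed.

(** Take the g-coefficient in the last factor on both sides of coassociativity. One side becomes the
    coaction of the coefficient ([L]), the other the coefficient tensored with g ([R]). *)
Lemma homog_coef g b : homog g (tcoef g (coact b)).
Proof.
have [[_ coA _] _ _ _] := cE.
have cL : linear (@tcoef k gT kG g) by exact: tcoef_linear.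
have coL : linear (@comul _ kG) by exact: linearP.
have idL (V : lmodType k) : linear (@idfun V) by [].
have L (x : E ⊗ kG) :
    tmap idfun (tcoef g) (tassoc (tmap (@coact _ _ _ E) idfun x)) = coact (tcoef g x).
  move: x; apply: eq_tens => [t x y|t x y|b' h].
  - by rewrite tmap_linear // tassoc_linear tmap_linear.
  - by rewrite tcoef_linear rhoL.
  rewrite tmap_tens // tcoef_tens.
  have [F FE] := linear_bundle rhoL; rewrite -FE linearZ FE.
  move: (coact b'); apply: eq_tens => [t x y|t x y|u v].
  - by rewrite tensDl tensZl tassoc_linear tmap_linear.
  - by rewrite /= scalerDr !scalerA mulrC.
  by rewrite tassoc_tens tmap_tens // tcoef_tens tensZr.
have R (x : E ⊗ kG) :
    tmap idfun (tcoef g) (tmap idfun comul x) = tcoef g x ⊗ gelt k g.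
  move: x; apply: eq_tens => [t x y|t x y|b' h].
  - by rewrite !tmap_linear.
  - by rewrite tcoef_linear tensDl tensZl.
  rewrite !tmap_tens // tcoef_tens tensZl -tensZr; congr (_ ⊗ _).
  move: h; apply: eq_gext => [t x y|t x y|x].
  - by rewrite coL cL.
  - by rewrite !ffunE scalerDl scalerA.
  rewrite [comul _]gcomul_gelt tcoef_gelt ffunE /=.
  by case: eqP => [->|_]; rewrite ?scale1r ?scale0r.
by rewrite /homog -L coA R.
Qed.

Lemma sum_coef (b : E) : b = \sum_g tcoef g (coact b).
Proof.
have [[_ _ co1] _ _ _] := cE.
have B : bilin (fun (b0 : E) (b1 : kG) => (counit b1 : k) *: b0).
  split=> [y|x] a u v; last by rewrite linearP scalerDl scalerA.
  by rewrite scalerDr !scalerA mulrC.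
rewrite -[LHS]co1 {1}(tcoefE (coact b)) tlift_sum //; apply: eq_bigr => g _.
by rewrite tlift_tens // [counit _]gcounit_gelt scale1r.
Qed.

Definition hunit g (u w : E) :=
  [/\ homog g u, homog g^-1%g w, u * w = 1 & w * u = 1].

(** At the grouplike element g, convolution inverse means inverse, so the cleaving map sends g to a
    unit of degree g. *)
Lemma hunit_exists g : exists uw, hunit g uw.1 uw.2.
Proof.
case: cE => _ _ _ [y [[yL yco] [y' [y'L yy' y'y]]]].
have B1 : bilin (fun u v : kG => y u * y' v).
  by split=> [v|u] a s t; rewrite ?yL ?y'L ?mulrDl ?mulrDr -?scalerAl -?scalerAr.
have B2 : bilin (fun u v : kG => y' u * y v).
  by split=> [v|u] a s t; rewrite ?yL ?y'L ?mulrDl ?mulrDr -?scalerAl -?scalerAr.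
have uw : y (gelt k g) * y' (gelt k g) = 1.
  have := yy' (gelt k g); rewrite [comul _]gcomul_gelt [counit _]gcounit_gelt.
  by rewrite tlift_tens // scale1r.
have wu : y' (gelt k g) * y (gelt k g) = 1.
  have := y'y (gelt k g); rewrite [comul _]gcomul_gelt [counit _]gcounit_gelt.
  by rewrite tlift_tens // scale1r.
have gu : homog g (y (gelt k g)).
  by rewrite /homog yco [comul _]gcomul_gelt tmap_tens.
exists (y (gelt k g), y' (gelt k g)); split=> //=.
(* The degree of the inverse w: multiply its coaction by 1 = (u ⊗ g)(w ⊗ g^-1) and use that
   [coact w * coact u] is 1. *)
rewrite /homog -[LHS]mulr1.
have -> : (1 : E ⊗ kG) = (y (gelt k g) ⊗ gelt k g) * (y' (gelt k g) ⊗ gelt k g^-1%g).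
  by rewrite tensM uw geltM mulgV.
by rewrite mulrA -gu -rhoM.2 wu rhoM.1 mul1r.
Qed.

Hypothesis A_comm : forall a b : A, a * b = b * a.

(** Conjugation by a homogeneous unit preserves degree one, that is, A. Every element of degree g
    lies in A u_g and A is commutative, so all of them induce the same map [sg g]. *)
Lemma action_exists : exists sg : gT -> A -> A,
  forall g b a, homog g b -> b * incl E a = incl E (sg g a) * b.
Proof.
have [uw uwP] := choice hunit_exists.
have /choice[sg sgP] (ga : gT * A) : exists c,
    (uw ga.1).1 * incl E ga.2 = incl E c * (uw ga.1).1.
  have [gu gw uw1 wu1] := uwP ga.1.
  have /homog1P[c cP] : homog 1%g ((uw ga.1).1 * incl E ga.2 * (uw ga.1).2).
    have := homogM (homogM gu (homog_incl ga.2)) gw.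
    by rewrite mulg1 mulgV.
  by exists c; rewrite cP -mulrA wu1 mulr1.
exists (fun g a => sg (g, a)) => g b a gb.
have [gu gw uw1 wu1] := uwP g.
have /homog1P[c cP] : homog 1%g (b * (uw g).2).
  by have := homogM gb gw; rewrite mulgV.
have -> : b = incl E c * (uw g).1 by rewrite cP -mulrA wu1 mulr1.
by rewrite -mulrA (sgP (g, a)) !mulrA -!inclM A_comm.
Qed.

Variable sg : gT -> A -> A.
Hypothesis sgE : forall g b a, homog g b -> b * incl E a = incl E (sg g a) * b.

(** A multiplicative choice of homogeneous elements suffices: multiplying the degree g component of
    b by [v g^-1] gives an element of degree one, which is its coefficient in A. *)
Lemma homog_frame (v : gT -> E) : v 1%g = 1 ->
  {morph v : g h / (g * h)%g >-> g * h} -> (forall g, homog g (v g)) -> frame v sg.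
Proof.
move=> v1 vM gv; split=> //.
- by move=> a g; exact: homog_inclM.
- by move=> g a; exact: sgE.
move=> b.
have /choice[a aE] g : exists a, incl E a = tcoef g (coact b) * v g^-1%g.
  by apply: homog1P; have := homogM (homog_coef g b) (gv g^-1%g); rewrite mulgV.
exists a; rewrite {1}(sum_coef b); apply: eq_bigr => g _.
by rewrite aE -mulrA -vM mulVg v1 mulr1.
Qed.

Lemma hunit_incl_inj g u w a b : hunit g u w -> incl E a * u = incl E b * u -> a = b.
Proof.
move=> [_ _ uw _] /(congr1 (fun x => x * w)); rewrite -!mulrA uw !mulr1.
exact: incl_inj.
Qed.

Lemma hunitM g h u v u' v' : hunit g u v -> hunit h u' v' ->
  hunit (g * h)%g (u * u') (v' * v).
Proof.
move=> [gu gv uv vu] [hu hv uv' vu']; split.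
- exact: homogM.
- by rewrite invMg; exact: homogM.
- by rewrite mulrA -[u * u' * v']mulrA uv' mulr1.
- by rewrite mulrA -[v' * v * u]mulrA vu mulr1.
Qed.

Lemma sgM g h a : sg g (sg h a) = sg (g * h)%g a.
Proof.
have [[u w] /= gu] := hunit_exists g; have [[u' w'] /= hu] := hunit_exists h.
have ghu := hunitM gu hu; have [[gU _ _ _] [hU _ _ _]] := (gu, hu).
have [ghU _ _ _] := ghu.
apply: (hunit_incl_inj ghu).
by rewrite -(sgE _ ghU) mulrA -(sgE _ gU) -mulrA -(sgE _ hU) mulrA.
Qed.

Lemma sg1 a : sg 1%g a = a.
Proof. by apply: incl_inj; have := sgE a homog1; rewrite mul1r mulr1. Qed.

Lemma sg_alg_hom g : alg_hom (sg g).
Proof.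
have [[u w] /= gu] := hunit_exists g; have [gU _ _ _] := gu.
split=> [t a b|]; last split=> [|a b]; apply: (hunit_incl_inj gu).
- rewrite -(sgE _ gU) !inclL mulrDr mulrDl -scalerAr -scalerAl.
  by rewrite !(sgE _ gU).
- by rewrite -(sgE _ gU) incl1 mulr1 mul1r.
by rewrite -(sgE _ gU) !inclM mulrA (sgE _ gU) -!mulrA (sgE _ gU).
Qed.

End Cleft.

(** * The action on the characters *)

Section Dichotomy.
Variables (k : closedFieldType) (p : nat).
Hypothesis charkp : p \in [pchar k].
Variables (gT : finGroupType).
Hypothesis abelG : (p.-abelem [set: gT])%g.
Variables (A : algType k) (T : finType) (chi : T -> A -> k^o).
Hypotheses (S : split_by chi) (cardT : #|T| = p).
Variable E : extension A (groupAlg k gT).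
Hypothesis cE : cleft E.

Let p_pr : prime p. Proof. exact: pcharf_prime charkp. Qed.
Let inclL : linear (@incl _ _ _ E). Proof. by case: cE => _ [[]]. Qed.
Let incl1 : incl E 1 = 1. Proof. by case: cE => _ [[_ []]]. Qed.
Let inclM : {morph @incl _ _ _ E : a b / a * b}. Proof. by case: cE => _ [[_ []]]. Qed.
Let incl_inj : injective (@incl _ _ _ E). Proof. by case: cE => _ []. Qed.

Lemma inclX a n : incl E (a ^+ n) = incl E a ^+ n.
Proof. by elim: n => [|n IHn]; rewrite ?incl1 // !exprS inclM IHn. Qed.

Lemma abelem_mulgC (g h : gT) : (g * h)%g = (h * g)%g.
Proof. by apply: (centsP (abelem_abelian abelG)); rewrite inE. Qed.

Lemma abelem_expg (g : gT) : (g ^+ p)%g = 1%g.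
Proof. by have [_ /(_ g (in_setT g))] := abelemP p_pr abelG. Qed.

Let A_comm := split_comm S.

Section Action.
Variable sg : gT -> A -> A.
Hypothesis sgE : forall g (b : E) a, homog g b -> b * incl E a = incl E (sg g a) * b.

Lemma homog_pow g (b : E) : homog g b -> homog 1%g (b ^+ p).
Proof. by move=> gb; rewrite -(abelem_expg g); exact: homogX. Qed.

Lemma comm_incl g (b : E) a : (forall c, sg g c = c) -> homog g b ->
  GRing.comm (incl E a) b.
Proof. by move=> gK gb; rewrite /GRing.comm (sgE _ gb) gK. Qed.

(** Since g^p = 1, the p-th powers of u and of its inverse have degree one, so they come from
    mutually inverse elements of A. *)
Lemma hunit_pow g (u w : E) : hunit g u w ->
  exists a b : A, incl E a = u ^+ p /\ a * b = 1.
Proof.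
move=> [gu gw uw wu].
have [a aE] := homog1P cE (homog_pow gu); have [b bE] := homog1P cE (homog_pow gw).
exists a, b; split=> //; apply: incl_inj.
by rewrite inclM aE bE -exprMn_comm ?uw ?expr1n // /GRing.comm uw wu.
Qed.

(** Rescale a unit u of degree g by c in A with c^p u^p = 1; c commutes with u because g acts
    trivially, so (c u)^p = 1. *)
Lemma unipotent_exists g : (forall a, sg g a = a) ->
  exists v : E, homog g v /\ v ^+ p = 1.
Proof.
move=> gK; have [[u w] /= gu] := hunit_exists cE g.
have [gU _ _ _] := gu; have [a [b [aE ab]]] := hunit_pow gu.
have [c ca] := split_root charkp S ab.
exists (incl E c * u); split; first exact: homog_inclM.
by rewrite exprMn_comm -?aE -?inclX -?inclM ?ca //; exact: comm_incl gU.
Qed.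

(** Two such elements differ by a factor a in A commuting with v, so a^p = 1, and then a = 1 in
    characteristic p. *)
Lemma unipotent_uniq g (v v' : E) : (forall a, sg g a = a) ->
  homog g v -> homog g v' -> v ^+ p = 1 -> v' ^+ p = 1 -> v' = v.
Proof.
move=> gK gv gv' vp v'p; have p_gt0 := prime_gt0 p_pr.
(* v^(p-1) is the inverse of v, so the quotient of v' by v has degree g^p = 1. *)
have [a aE] : exists a, incl E a = v' * v ^+ p.-1.
  apply: (homog1P cE); have := homogM cE gv' (homogX cE p.-1 gv).
  by rewrite -expgS prednK // abelem_expg.
have v'E : v' = incl E a * v by rewrite aE -mulrA -exprSr prednK // vp mulr1.
suff a1 : a = 1 by rewrite v'E a1 incl1 mul1r.
apply: (split_root1 charkp S); apply: incl_inj.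
rewrite inclX incl1 -v'p v'E exprMn_comm ?vp ?mulr1 //; exact: comm_incl gv.
Qed.

(** The group is abelian, so b v b^-1 again has degree g, and its p-th power is 1; by uniqueness it
    equals v. The degree h of b may act nontrivially. *)
Lemma unipotent_comm g h (v b : E) : (forall a, sg g a = a) ->
  homog g v -> v ^+ p = 1 -> homog h b -> b ^+ p = 1 -> GRing.comm v b.
Proof.
move=> gK gv vp hb bp; have p_gt0 := prime_gt0 p_pr.
have bV : b * b ^+ p.-1 = 1 by rewrite -exprS prednK.
have Vb : b ^+ p.-1 * b = 1 by rewrite -exprSr prednK.
have /esym E1 : b * v * b ^+ p.-1 = v.
  apply: (unipotent_uniq gK gv) => //.
    have := homogM cE (homogM cE hb gv) (homogX cE p.-1 hb).
    by rewrite (abelem_mulgC h) -mulgA -expgS prednK // abelem_expg mulg1.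
  have X n : (b * v * b ^+ p.-1) ^+ n = b * v ^+ n * b ^+ p.-1.
    elim: n => [|n IHn]; first by rewrite mulr1 bV.
    by rewrite !exprS IHn !mulrA -[_ * b ^+ p.-1 * b]mulrA Vb mulr1.
  by rewrite X vp mulr1.
by rewrite /GRing.comm {1}E1 -mulrA Vb mulr1.
Qed.

(** The product of [v g] and [v h] has degree gh and p-th power 1, so by uniqueness it is
    [v (g * h)]. *)
Lemma unipotent_hom (K : {group gT}) : (forall g, g \in K -> forall a, sg g a = a) ->
  exists v : gT -> E, [/\ forall g, g \in K -> homog g (v g),
    forall g, g \in K -> v g ^+ p = 1, v 1%g = 1
    & {in K &, {morph v : g h / (g * h)%g >-> g * h}}].
Proof.
move=> KP.
have /choice[v vP] g : exists v : E, g \in K -> homog g v /\ v ^+ p = 1.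
  (* Outside K the value 1 is only a default. *)
  have [gK|_] := boolP (g \in K); last by exists 1.
  by have [v vP] := unipotent_exists (KP g gK); exists v.
have hv g (gK : g \in K) := (vP g gK).1; have vp g (gK : g \in K) := (vP g gK).2.
exists v; split; [exact: hv|exact: vp| |move=> g h gK hK].
  apply: (unipotent_uniq (KP _ (group1 K))); rewrite ?expr1n ?vp ?group1 //.
  - exact: homog1.
  - exact/hv/group1.
have cvv : GRing.comm (v g) (v h).
  exact: unipotent_comm (KP _ gK) (hv _ gK) (vp _ gK) (hv _ hK) (vp _ hK).
apply: (unipotent_uniq (KP _ (groupM gK hK))); rewrite ?vp ?groupM //.
- exact: homogM (hv _ gK) (hv _ hK).
- exact/hv/groupM.
by rewrite exprMn_comm // !vp // mulr1.
Qed.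

Lemma trivial_action_frame : (forall g a, sg g a = a) -> exists v : gT -> E, frame v sg.
Proof.
move=> sgK; have [v [hv _ v1 vM]] := @unipotent_hom [set: gT]%G (fun g _ => sgK g).
exists v; apply: homog_frame => // [g h|g]; first by rewrite vM ?inE.
by apply: hv; rewrite inE.
Qed.

Section Nontrivial.
Variables (c : gT) (t0 : T) (a0 : A).
Hypothesis ct0 : chi t0 (sg c a0) <> chi t0 a0.

Let sgMM := sgM cE sgE.
Let sg1 := sg1 cE sgE.

Lemma cycle_order : #[c]%g = p.
Proof.
apply: (abelem_order_p abelG); rewrite ?inE //.
by apply/eqP => c1; apply: ct0; rewrite c1 sg1.
Qed.

(** A nontrivial x in the group <c> of prime order generates c; if x fixed the character t0, so
    would c. *)
Lemma cycle_faithful x : x \in <[c]>%g ->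
  (forall a, chi t0 (sg x a) = chi t0 a) -> x = 1%g.
Proof.
move=> cx xt0; apply/eqP/negPn/negP => x1; apply: ct0.
have xX n a : chi t0 (sg (x ^+ n)%g a) = chi t0 a.
  by elim: n a => [|n IHn] a; rewrite ?sg1 // expgS -sgMM xt0.
have /cycleP[n ->//] : c \in <[x]>%g.
suff -> : <[x]>%g = <[c]>%g by exact: cycle_id.
apply/eqP; rewrite eqEcard cycle_subG cx /= -!orderE cycle_order.
by rewrite (abelem_order_p abelG) ?inE.
Qed.

(** Composing the character t0 with the automorphism [sg x] gives a character, which is one of the
    chi by [split_char]. *)
Lemma orbit_exists : exists r : gT -> T, forall x a, chi (r x) a = chi t0 (sg x a).
Proof.
suff H x : exists t, forall a, chi t a = chi t0 (sg x a) by have [r rE] := choice H; exists r.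
have [t tE] : exists t, (fun a => chi t0 (sg x a)) =1 chi t.
  apply: (split_char S); have [sL [s1 sM]] := sg_alg_hom cE sgE x.
  split=> [u a b|]; first by rewrite sL (split_hom S t0).1.
  split=> [|a b] /=; first by rewrite s1 (split_by1 S).
  by rewrite sM (split_byM S).
by exists t => a; rewrite tE.
Qed.

Variable r : gT -> T.
Hypothesis rE : forall x a, chi (r x) a = chi t0 (sg x a).

Lemma orbit_inj : {in <[c]>%g &, injective r}.
Proof.
move=> x y cx cy rxy; apply/eqP; rewrite eq_mulgV1; apply/eqP.
apply: cycle_faithful => [|a]; first by rewrite groupM ?groupV.
by rewrite -sgMM -rE rxy rE sgMM mulgV sg1.
Qed.

(** The orbit of t0 under <c> consists of p distinct characters, and there are only p. *)
Lemma orbit_surj t : exists2 x, x \in <[c]>%g & r x = t.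
Proof.
have /imsetP[x cx ->] : t \in [set r x | x in <[c]>%g]; last by exists x.
suff -> : [set r x | x in <[c]>%g] = setT by rewrite inE.
apply/eqP; rewrite eqEcard subsetT cardsT cardT (card_in_imset orbit_inj).
by rewrite -orderE cycle_order leqnn.
Qed.

(** In an abelian group acting transitively, an element fixing one point fixes all of them. *)
Lemma stabilizer_trivial x : (forall a, chi t0 (sg x a) = chi t0 a) ->
  forall a, sg x a = a.
Proof.
move=> xt0 a; apply: (split_inj S) => t; have [y _ <-] := orbit_surj t.
by rewrite !rE sgMM abelem_mulgC -sgMM xt0.
Qed.

(** Any g moves t0 to the same character as some x in <c>, so x^-1 g fixes t0 and lies in the
    kernel. Faithfulness of <c> makes the intersection trivial. *)
Lemma kernel_exists : exists2 K : {group gT}, (<[c]> \x K)%g = [set: gT]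
  & forall g, g \in K -> forall a, sg g a = a.
Proof.
pose K := [set g | `[< forall a, sg g a = a >]].
have KP g : g \in K -> forall a, sg g a = a by rewrite inE => /asboolP.
have gK : group_set K.
  apply/group_setP; split=> [|g h /KP gK /KP hK]; rewrite inE; apply/asboolP => a.
    exact: sg1.
  by rewrite -sgMM hK gK.
exists (Group gK) => //; rewrite dprodE /=.
- apply/eqP; rewrite -subTset; apply/subsetP => g _.
  have [x cx rx] := orbit_surj (r g).
  apply/mulsgP; exists x (x^-1 * g)%g; rewrite ?mulKVg //.
  rewrite inE; apply/asboolP; apply: stabilizer_trivial => a.
  by rewrite abelem_mulgC -sgMM -rE -rx rE sgMM mulgV sg1.
- by apply/centsP => x _ y _; exact: abelem_mulgC.
apply/setP => x; rewrite in_setI in_set1; apply/andP/eqP => [[cx /KP xK]|->].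
  by apply: cycle_faithful => // a; rewrite xK.
by rewrite group1; case/group_setP: gK.
Qed.

Lemma cycle_unipotent : exists v : E, homog c v /\ v ^+ p = 1.
Proof.
have [[u w] /= cu] := hunit_exists cE c; have [cU _ _ _] := cu.
have [a [b [aE ab]]] := hunit_pow cu.
(* Here a = u^p, which commutes with u. *)
have ca : sg c a = a.
  by apply: (hunit_incl_inj cE cu); rewrite -(sgE _ cU) aE -exprSr -exprS.
have cXa n : sg (c ^+ n)%g a = a.
  by elim: n => [|n IHn]; rewrite ?sg1 // expgS -sgMM IHn.
(* An element fixed by c takes one value on the whole orbit, hence at every character, so it is a
   scalar; a p-th root of its inverse can be taken in k and commutes with u. *)
have aS : a = (chi t0 a : k) *: 1.
  apply: (split_inj S) => t; rewrite (split_byZ S) (split_by1 S) mulr1.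
  by have [x /cycleP[n ->] <-] := orbit_surj t; rewrite rE cXa.
have ca_neq0 : chi t0 a != 0.
  apply/eqP => ca_eq0; have := split_by1 S t0; rewrite -ab (split_byM S) ca_eq0 mul0r.
  by move/esym/eqP; rewrite oner_eq0.
have [m mE] := closed_root charkp (chi t0 a)^-1.
exists (m *: u); split; first exact: homogZ.
have [I IE] := linear_bundle inclL.
have iaE : incl E a = (chi t0 a : k) *: 1 by rewrite {1}aS -IE linearZ IE incl1.
by rewrite exprZn mE -aE iaE scalerA mulVf // scale1r.
Qed.

Lemma nontrivial_action_frame (K : {group gT}) : (<[c]> \x K)%g = [set: gT] ->
  (forall g, g \in K -> forall a, sg g a = a) -> exists v : gT -> E, frame v sg.
Proof.
move=> cK KP; have [vc [hvc vcp]] := cycle_unipotent.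
have [vK [hvK vKp vK1 vKM]] := unipotent_hom KP.
have vcK g n : g \in K -> vK g * vc ^+ n = vc ^+ n * vK g.
  move=> gK; apply: commrX.
  by apply: (unipotent_comm (KP _ gK)) hvc vcp; rewrite ?vKp //; exact: hvK.
(* The direct product determines d and c^i, hence i only modulo p; vc^p = 1 makes vc^i vK(d) well
   defined. *)
have wd i j d d' : d \in K -> d' \in K -> (c ^+ i * d = c ^+ j * d')%g ->
    vc ^+ i * vK d = vc ^+ j * vK d'.
  move=> dK d'K cd.
  have [x [y [_ _ _ xyP]]] := mem_dprod cK (in_setT (c ^+ i * d)%g).
  have [ci ->] := xyP _ _ (mem_cycle c i) dK erefl.
  have [cj ->] := xyP _ _ (mem_cycle c j) d'K cd.
  congr (_ * _); move/eqP: (etrans ci (esym cj)).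
  rewrite eq_expg_mod_order cycle_order => /eqP ij.
  by rewrite -(expr_mod i vcp) ij expr_mod.
have /choice[v vP] g : exists v : E, exists i d,
    [/\ d \in K, g = (c ^+ i * d)%g & v = vc ^+ i * vK d].
  have [x [d [/cycleP[i ->] dK -> _]]] := mem_dprod cK (in_setT g).
  by exists (vc ^+ i * vK d), i, d.
exists v; apply: homog_frame => // [|g h|g].
- have [i [d [dK g1 ->]]] := vP 1%g.
  by rewrite (wd i 0%N d 1%g) ?group1 // ?vK1 ?mulr1 // -g1 mulg1.
- have [i [d [dK gE ->]]] := vP g; have [j [e [eK hE ->]]] := vP h.
  have [l [f [fK ghE ->]]] := vP (g * h)%g.
  rewrite (wd l (i + j)%N f (d * e)%g) ?groupM //.
    by rewrite exprD vKM // !mulrA -[X in _ = X * _]mulrA vcK // !mulrA.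
  by rewrite -ghE gE hE expgD -!mulgA; congr (_ * _)%g; rewrite !mulgA (abelem_mulgC d).
have [i [d [dK gE ->]]] := vP g; rewrite gE.
by apply: homogM => //; [exact: homogX | exact: hvK].
Qed.

End Nontrivial.

End Action.

Theorem cleft_dichotomy : exists (v : gT -> E) (sg : gT -> A -> A),
  frame v sg /\
  ((forall g a, sg g a = a) \/
   exists (C K : {group gT}) (t0 : T) (r : gT -> T),
     [/\ (C \x K)%g = [set: gT], (C \isog Zp p)%g,
         forall g, g \in K -> forall a, sg g a = a, {in C &, injective r}
       & forall x a, chi (r x) a = chi t0 (sg x a)]).
Proof.
have [sg sgE] := action_exists cE A_comm.
have [triv|] := pselect (forall g a, sg g a = a).
  by have [v Fr] := trivial_action_frame sgE triv; exists v, sg; split=> //; left.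
move=> ntriv; have [c [t0 [a0 ct0]]] : exists c t0 a0, chi t0 (sg c a0) <> chi t0 a0.
  apply: contrapT => H; apply: ntriv => c a; apply: (split_inj S) => t.
  by apply: contrapT => ct; apply: H; exists c, t, a.
have [r rE] := orbit_exists sgE t0.
have [K cK KP] := kernel_exists sgE ct0 rE.
have [v Fr] := nontrivial_action_frame sgE ct0 rE cK KP.
exists v, sg; split=> //; right; exists <[c]>%G, K, t0, r; split=> //.
  rewrite isog_cyclic_card ?cycle_cyclic // -orderE (cycle_order sgE ct0).
  by rewrite prime_cyclic card_Zp ?prime_gt0 // eqxx.
exact: (orbit_inj sgE ct0 rE).
Qed.

End Dichotomy.

(** * The algebra k[x]/(x^p - x) *)

Section ASalgebra.
Variables (k : fieldType) (p : nat).
Hypothesis charkp : p \in [pchar k].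
Let p_pr : prime p. Proof. exact: pcharf_prime charkp. Qed.
Local Notation h := ('X^p - 'X : {poly k}).

Lemma natr_pchar_inj (i j : 'I_p) : i%:R = j%:R :> k -> i = j.
Proof.
wlog ij : i j / (j <= i)%N.
  by move=> W; have [ij|/ltnW ij] := leqP j i => [|/esym] /W-/(_ ij).
move=> /eqP; rewrite -subr_eq0 -natrB // -(dvdn_pcharf charkp).
have ip : (i - j < p)%N by exact: leq_ltn_trans (leq_subr _ _) (ltn_ord i).
have [/eqP|ij0] := posnP (i - j)%N; last by rewrite gtnNdvd.
by rewrite subn_eq0 => ji _; apply/val_inj/eqP; rewrite eqn_leq ij ji.
Qed.

Lemma ASpoly_size : size h = p.+1.
Proof. by rewrite size_polyDl size_polyXn // size_polyN size_polyX ltnS prime_gt1. Qed.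

Lemma ASpoly_monic : h \is monic.
Proof.
rewrite monicE lead_coefDl ?lead_coefXn //.
by rewrite size_polyXn size_polyN size_polyX ltnS prime_gt1.
Qed.

(** Quotient polynomials are reduced modulo [mk_monic h], which is h itself only for h monic and
    nonconstant. *)
Lemma AS_mk_monic : mk_monic h = h.
Proof. by rewrite /mk_monic ASpoly_size ltnS prime_gt0 // ASpoly_monic. Qed.

Lemma ASpoly_root (i : nat) : h.[i%:R] = 0.
Proof.
by rewrite !hornerE -(pFrobenius_autE charkp) pFrobenius_aut_nat subrr.
Qed.

Lemma horner_rmodp_AS (q : {poly k}) (i : nat) :
  (Pdiv.Ring.rmodp q (mk_monic h)).[i%:R] = q.[i%:R].
Proof.
rewrite AS_mk_monic {2}(Pdiv.RingMonic.rdivp_eq ASpoly_monic q).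
by rewrite hornerD hornerM ASpoly_root mulr0 add0r.
Qed.

(** The p elements i of the prime field are distinct roots of X^p - X, so evaluation at them is well
    defined on the quotient. *)
Lemma ASalg_split :
  split_by (fun (i : 'I_p) (a : ASalg k p) => (a : {poly k}).[i%:R] : k^o).
Proof.
split=> [i|a b ab|f].
- split=> [t a b|]; first by rewrite /= hornerD hornerZ.
  split=> [|a b]; first by rewrite /= hornerC.
  by rewrite poly_of_qpolyM horner_rmodp_AS hornerM.
- apply/val_inj/eqP; rewrite -subr_eq0; set d := (X in X == 0).
  apply/negPn/negP => nz.
  (* A nonzero difference d would vanish at p distinct points, but its size is at most p, so its
     degree is less than p. *)
  pose rs := [seq i%:R : k | i : 'I_p <- enum 'I_p].
  have : (size rs < size d)%N.
    apply: max_poly_roots => //.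
      apply/allP => x /mapP[i _ ->]; rewrite rootE hornerD hornerN subr_eq0.
      exact/eqP/ab.
    by rewrite map_inj_uniq ?enum_uniq // => i j; exact: natr_pchar_inj.
  rewrite size_map -cardE card_ord ltnNge.
  apply/negP; rewrite negbK (leq_trans (size_polyD _ _)) // size_polyN geq_max.
  have sz (c : ASalg k p) : (size (c : {poly k}) <= p)%N.
    by rewrite -ltnS; apply: leq_trans (size_mk_monic c) _; rewrite AS_mk_monic ASpoly_size.
  by rewrite !sz.
(* Surjectivity is Lagrange interpolation; reduction modulo h does not change the values at the
   roots. *)
pose e (i : 'I_p) : {poly k} := \prod_(j < p | j != i) ('X - (j%:R)%:P).
have ei i : (e i).[i%:R] != 0.
  rewrite horner_prod; apply/prodf_neq0 => j ji; rewrite hornerXsubC subr_eq0.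
  by apply: contraNneq ji => /natr_pchar_inj ->.
have ej i j : i != j -> (e i).[j%:R] = 0.
  move=> ij; rewrite horner_prod (bigD1 j) 1?eq_sym //= hornerXsubC subrr.
  by rewrite mul0r.
exists (in_qpoly h (\sum_i (f i / (e i).[i%:R]) *: e i)) => j.
rewrite /= horner_rmodp_AS horner_sum (bigD1 j) //= big1 => [|i ij].
  by rewrite hornerZ divfK // addr0.
by rewrite hornerZ (ej _ _ ij) mulr0.
Qed.

End ASalgebra.

(** A simply transitive orbit lists all the characters, so they can be indexed by the acting
    group. *)
Lemma split_orbit (k : fieldType) (A : algType k) (T : finType) (chi : T -> A -> k^o)
    (gT hT : finGroupType) (sg : gT -> A -> A) (t0 : T) (r : gT -> T) (j : hT -> gT) :
  split_by chi -> (forall x a, chi (r x) a = chi t0 (sg x a)) ->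
  injective (r \o j) -> #|T| = #|hT| ->
  split_by (fun x a => chi t0 (sg (j x) a)).
Proof.
move=> S rE rj cardT; apply: (split_reindex (r := r \o j) S) => [|x a]; last exact: rE.
by apply: inj_card_bij => //; rewrite cardT.
Qed.

(** * Comparison with the trivial and Heisenberg extensions *)

Section Final.
Variables (k : closedFieldType) (p : nat).
Hypothesis charkp : p \in [pchar k].
Variables (gT : finGroupType).
Let p_pr : prime p. Proof. exact: pcharf_prime charkp. Qed.

Lemma isog_Zp_card (hT : finGroupType) (C : {group hT}) : (C \isog Zp p)%g -> #|C| = p.
Proof. by move=> /card_isog ->; rewrite card_Zp ?prime_gt0. Qed.

Lemma twist_trivial (A : algType k) (E : extension A (groupAlg k gT)) v sg :
  frame (E := E) v sg -> (forall g a, sg g a = a) ->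
  twist_equivalent E (trivial_ext A (groupAlg k gT)).
Proof.
move=> Fr sgK; apply: (frame_twist Fr (trivial_frame _ _) (phi := idfun)) => //.
by split=> //; exists idfun.
Qed.

(** The map theta sending a to x |-> chi_{t0}(x . a) turns the action of C into translation of
    functions. For an arbitrary identification psi, the automorphism psi^-1 theta of A absorbs the
    difference between psi and theta. *)
Lemma twist_heisenberg_tensor (A : algType k) (T : finType) (chi : T -> A -> k^o)
    (E : extension A (groupAlg k gT)) v sg (C K : {group gT}) t0 r :
  split_by chi -> #|T| = #|C| -> frame (E := E) v sg -> (C \x K)%g = [set: gT] ->
  (forall g, g \in K -> forall a, sg g a = a) -> {in C &, injective r} ->
  (forall x a, chi (r x) a = chi t0 (sg x a)) ->
  (exists psi : A -> dual (groupAlg k (subg_of C)), alg_iso psi) /\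
  forall psi : A -> dual (groupAlg k (subg_of C)), alg_iso psi ->
    twist_equivalent E
      (transport_ext psi (groupAlg_prod (C := C) (D := K))
         (tensor_ext (heisenberg_ext (groupAlg k (subg_of C)))
            (groupAlg k (subg_of K)))).
Proof.
move=> S cardT Fr CK KP r_inj rE.
have S' : split_by (fun (x : subg_of C) a => chi t0 (sg (sgval x) a)).
  apply: (split_orbit S rE) => [x y /= /r_inj|].
    by move=> /(_ (subgP x) (subgP y)) /val_inj.
  by rewrite cardT -cardsT; apply/card_isog/isog_subg.
have [theta theta_iso thetaE] := split_dual_iso S'.
split=> [|psi [psi_hom [psi' psiK psi'K]]]; first by exists theta.
have [c [d [cd Fr']]] := transport_frame CK psi_hom psiK psi'K (heisenberg_frame k _).
apply: (frame_twist Fr Fr' (phi := psi' \o theta)).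
  exact: alg_iso_comp theta_iso (alg_iso_inv psi_hom psiK psi'K).
(* At x both sides are values of chi_{t0}, at (x g) . a and at (x c(g)) . a; they agree because g =
   c(g) d(g) and d(g) in K acts trivially. *)
move=> g a /=; rewrite psi'K; congr (psi' _); apply: dual_ext => x.
rewrite hitE geltM !thetaE (frame_sgM Fr) -{1}(cd g) mulgA -(frame_sgM Fr).
by rewrite (KP _ (subgP _)) morphM ?inE.
Qed.

End Final.

Theorem proposition6p9 (k : closedFieldType) (p : nat) (charkp : p \in [pchar k])
    (gT : finGroupType) (abelG : (p.-abelem [set: gT])%g) :
  (forall E : extension (ASalg k p) (groupAlg k gT),
     cleft E ->
     twist_equivalent E (trivial_ext (ASalg k p) (groupAlg k gT))
     \/
     exists C G' : {group gT},
       [/\ (C \isog Zp p)%g, (C \x G')%g = [set: gT],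
           exists psi : ASalg k p ->
                        dual (groupAlg k (subg_of C)), alg_iso psi
         & forall psi : ASalg k p ->
                        dual (groupAlg k (subg_of C)), alg_iso psi ->
             twist_equivalent E
               (transport_ext psi (groupAlg_prod (C := C) (D := G'))
                  (tensor_ext (heisenberg_ext (groupAlg k (subg_of C)))
                     (groupAlg k (subg_of G'))))])
  /\
  (([set: gT] \isog Zp p)%g ->
   forall E : extension (dual (groupAlg k gT)) (groupAlg k gT),
     cleft E ->
     twist_equivalent E (trivial_ext (dual (groupAlg k gT)) (groupAlg k gT)) \/
     twist_equivalent E (heisenberg_ext (groupAlg k gT))).
Proof.
split=> [E cE|isoG E cE].
  have S := ASalg_split charkp.
  have [v [sg [Fr [triv|]]]] := cleft_dichotomy charkp abelG S (card_ord p) cE.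
    by left; exact: twist_trivial Fr triv.
  move=> [C [K [t0 [r [CK isoC KP r_inj rE]]]]]; right; exists C, K.
  have cardT : #|'I_p| = #|C| by rewrite card_ord (isog_Zp_card charkp isoC).
  by have [] := twist_heisenberg_tensor S cardT Fr CK KP r_inj rE.
(* Here the characters of A are the elements of the group, which number p. *)
have S := dual_split k gT.
have cardG : #|gT| = p by rewrite -cardsT; exact: (isog_Zp_card charkp isoG).
have [v [sg [Fr [triv|]]]] := cleft_dichotomy charkp abelG S cardG cE.
  by left; exact: twist_trivial Fr triv.
move=> [C [K [t0 [r [CK isoC KP r_inj rE]]]]]; right.
(* C has order p, so it is the whole group, which therefore indexes all the characters through r. *)
have CG : C :=: setT.
  by apply/eqP; rewrite eqEcard subsetT cardsT cardG (isog_Zp_card charkp isoC) leqnn.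
have S' := split_orbit (j := idfun) S rE.
have [|//|theta theta_iso thetaE] := split_dual_iso (S' _ _).
  by move=> x y /=; apply: r_inj; rewrite CG inE.
apply: (frame_twist Fr (heisenberg_frame k gT) theta_iso) => g a.
by apply: dual_ext => x; rewrite hitE geltM !thetaE (frame_sgM Fr).
Qed.
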